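(* Let $k$ be a commutative rig. The cartesian differential category $\mathsf{Fa\grave a}(k\text{-Mod}_w)$ is induced by the differential modality $Q$ on $k\text{-Mod}$; that is, there is an isomorphism of cartesian differential categories $\mathrm{Kl}(Q)\cong\mathsf{Fa\grave a}(k\text{-Mod}_w)$, where $\mathrm{Kl}(Q)$ is the co-Kleisli category of $Q$.
   Context: Fix a commutative rig (semiring) $k$. $k\text{-Mod}$ is the category of $k$-modules and $k$-linear maps; $k\text{-Mod}_w$ is the category of $k$-modules and arbitrary functions. **Cartesian differential categories.** A *left-$k$-linear category* is a category whose hom-sets are $k$-modules with each $(-)\circ f$ $k$-linear; it is *cartesian* if it has finite products and the bijections $\mathcal{A}(A,B\times C)\to\mathcal{A}(A,B)\oplus\mathcal{A}(A,C)$ are $k$-linear. $k\text{-Mod}_w$ is such, with pointwise $k$-module structure on homs. Write $h(x_1,\dots,x_n)$ for $h\circ(x_1,\dots,x_n)$. A *cartesian differential category* is a cartesian left-$k$-linear category with operators $\mathrm{D}\colon\mathcal{A}(A,B)\to\mathcal{A}(A\times A,B)$ such that: (i) $\mathrm{D}$ is $k$-linear; (ii) $\mathrm{D}f$ is $k$-linear in its second argument; (iii) $\mathrm{D}(\pi_i)=\pi_i\pi_1$; (iv) $\mathrm{D}(1_A)=\pi_1$; (v) $\mathrm{D}(gf)=\mathrm{D}g(f\pi_0,\mathrm{D}f)$; (vi) $\mathrm{D}(\mathrm{D}f)(x,r,0,v)=\mathrm{D}f(x,v)$; (vii) $\mathrm{D}(\mathrm{D}f)(x,r,s,0)=\mathrm{D}(\mathrm{D}f)(x,s,r,0)$.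 An isomorphism of cartesian differential categories is an isomorphism of categories preserving the $k$-module structure on homs, finite products and $\mathrm{D}$. **The Faà di Bruno category.** For a cartesian left-$k$-linear category $\mathcal{A}$, $\mathsf{Fa\grave a}(\mathcal{A})$ has the objects of $\mathcal{A}$; maps $f^{(\bullet)}\colon A\rightsquigarrow B$ are families $(f^{(n)}\colon A\times A^n\to B)_{n\in\mathbb{N}}$ of maps in $\mathcal{A}$, each symmetric and $k$-linear in each of its last $n$ variables (in $k\text{-Mod}_w$: multilinear in the usual sense). Identities: $\mathrm{id}^{(0)}=\mathrm{id}$, $\mathrm{id}^{(1)}=\pi_1$, $\mathrm{id}^{(n)}=0$ for $n\ge2$. Composition: $(g\circ f)^{(n)}=\sum_{[n]=A_1|\dots|A_r}g^{(r)}\circ(f^{(\emptyset)},f^{(A_1)},\dots,f^{(A_r)})$, the sum over unordered partitions of $[n]=\{1,\dots,n\}$ into non-empty subsets, with $f^{(I)}(x_0,\dots,x_n)=f^{(s)}(x_0,x_{i_1},\dots,x_{i_s})$ for $I=\{i_1<\dots<i_s\}$. The $k$-module structure on homs is componentwise; products are as in $\mathcal{A}$ on objects, with projections $\pi_i^{(0)}=\pi_i$, $\pi_i^{(1)}=\pi_i\pi_1$, $\pi_i^{(n)}=0$ for $n\ge2$. It is a cartesian differential category with $(\mathrm{D}f)^{(n)}(x_0,y_0,\dots,x_n,y_n)=f^{(n+1)}(x_0,\dots,x_n,y_0)+\sum_{i=1}^nf^{(n)}(x_0,\dots,x_{i-1},y_i,x_{i+1},\dots,x_n)$. **The differential modality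 $Q$** (in the paper, the ''initial monoidal differential modality'' on $k\text{-Mod}$). $QA=\bigoplus_{x\in A}\mathrm{Sym}(A)$, with $\mathrm{Sym}(A)$ the free symmetric $k$-algebra; $\langle x_0,\dots,x_n\rangle$ is the image of $x_1\otimes\cdots\otimes x_n$ in the summand indexed by $x_0$. For $I=\{i_1<\dots<i_s\}\subseteq[n]$, $\langle x_I\rangle=\langle x_0,x_{i_1},\dots,x_{i_s}\rangle$. Then $Qf\langle x_0,\dots,x_n\rangle=\langle fx_0,\dots,fx_n\rangle$; the comonad counit is $\varepsilon\langle x_0\rangle=x_0$, $\varepsilon\langle x_0,x_1\rangle=x_1$, $\varepsilon\langle x_0,\dots,x_n\rangle=0$ for $n\ge2$; the comultiplication is $\delta\langle x_0,\dots,x_n\rangle=\sum_{[n]=A_1|\dots|A_r}\langle\langle x_0\rangle,\langle x_{A_1}\rangle,\dots,\langle x_{A_r}\rangle\rangle$; the comonoid structure on $QA$ is $e\langle x_0\rangle=1$, $e\langle x_0,\dots,x_n\rangle=0$ for $n\ge1$, $\Delta\langle x_0,\dots,x_n\rangle=\sum_{I\subseteq[n]}\langle x_I\rangle\otimes\langle x_{[n]\setminus I}\rangle$; the deriving transformation is $\mathsf{d}\colon QA\otimes A\to QA$, $\langle x_0,\dots,x_n\rangle\otimes y\mapsto\langle x_0,\dots,x_n,y\rangle$. **Co-Kleisli category.** $\mathrm{Kl}(Q)(A,B)=k\text{-Mod}(QA,B)$ with its $k$-module structure; finite products are those of $k\text{-Mod}$ (projections $\pi_i\circ\varepsilon$);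 and for $f\colon QA\to B$, $\mathrm{D}f$ is the composite $Q(A\times A)\xrightarrow{\Delta}Q(A\times A)\otimes Q(A\times A)\xrightarrow{Q\pi_0\otimes Q\pi_1}QA\otimes QA\xrightarrow{1\otimes\varepsilon}QA\otimes A\xrightarrow{\mathsf{d}}QA\xrightarrow{f}B$. This makes $\mathrm{Kl}(Q)$ a cartesian differential category. *)

(* Defs.v *)
From HB Require Import structures.
From mathcomp Require Import perm all_boot all_algebra finmap.
From mathcomp Require Import boolp.
Set Implicit Arguments.
Unset Strict Implicit.
Unset Printing Implicit Defensive.
Import GRing.Theory.
Local Open Scope ring_scope.
Local Open Scope quotient_scope.

Section LinearMaps.
Variable k : comPzSemiRingType.
Implicit Types U V W : lSemiModType k.

(* Compatibility with 0 is the case of the scalar 0. *)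
Definition is_linear U V (f : U -> V) : Prop :=
  scalable f /\ {morph f : u v / u + v}.

Definition bilinear U V W (f : U -> V -> W) : Prop :=
  (forall u, is_linear (f u)) /\ (forall v, is_linear (f^~ v)).

Lemma linear_is_linear U V (f : {linear U -> V}) : is_linear f.
Proof. split=> [a u|u v]; [exact: linearZ_LR | exact: linearD]. Qed.

Lemma is_linear_semilinear U V (f : U -> V) : is_linear f -> semilinear f.
Proof. by case. Qed.

Definition mklin U V (f : U -> V) (fL : is_linear f) : {linear U -> V} :=
  HB.pack f (GRing.isSemilinear.Build k U V *:%R f (is_linear_semilinear fL)).

Lemma is_linear0 U V (f : U -> V) : is_linear f -> f 0 = 0.
Proof. by move=> fL; exact: (linear0 (mklin fL)). Qed.

Lemma is_linear_sum U V (f : U -> V) (I : Type) (r : seq I) P (E : I -> U) :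
  is_linear f -> f (\sum_(i <- r | P i) E i) = \sum_(i <- r | P i) f (E i).
Proof. by move=> fL; exact: (linear_sum (mklin fL)). Qed.

Lemma is_linear_comp U V W (g : V -> W) (f : U -> V) :
  is_linear g -> is_linear f -> is_linear (g \o f).
Proof.
by move=> [gZ gD] [fZ fD]; split=> [a u|u v] /=; rewrite (fZ, fD) (gZ, gD).
Qed.

Lemma is_linear_zero U V : is_linear (fun _ : U => 0 : V).
Proof. by split=> [a u|u v]; rewrite ?scaler0 ?addr0. Qed.

Lemma is_linear_id U : is_linear (@id U).
Proof. by []. Qed.

Lemma is_linear_add U V (f g : U -> V) :
  is_linear f -> is_linear g -> is_linear (fun u => f u + g u).
Proof.
move=> [fZ fD] [gZ gD]; split=> [a u|u v]; first by rewrite fZ gZ scalerDr.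
by rewrite fD gD addrACA.
Qed.

Lemma is_linear_bigsum U V (I : Type) (r : seq I) (P : pred I)
    (F : I -> U -> V) :
  (forall i, P i -> is_linear (F i)) ->
  is_linear (fun u => \sum_(i <- r | P i) F i u).
Proof.
move=> FL; split=> [a u|u v].
  by rewrite scaler_sumr; apply: eq_bigr => i /FL[FZ _]; rewrite FZ.
by rewrite -big_split; apply: eq_bigr => i /FL[_ FD]; rewrite FD.
Qed.

Lemma is_linear_scale U V (f : U -> V) a :
  is_linear f -> is_linear (fun u => a *: f u).
Proof.
move=> [fZ fD]; split=> [b u|u v]; last by rewrite fD scalerDr.
by rewrite fZ !scalerA mulrC.
Qed.

Lemma lin_ext U V (f g : {linear U -> V}) : f =1 g -> f = g.
Proof.
case: f => f [[f1] [f2]]; case: g => g [[g1] [g2]] /= fg.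
have ? : f = g by apply/funext.
by subst g; rewrite (Prop_irrelevance f1 g1) (Prop_irrelevance f2 g2).
Qed.

End LinearMaps.

(* The free symmetric k-algebra on A: terms for the algebra operations on
   generators from A, modulo the least congruence that contains the axioms of
   commutative k-algebras and makes the inclusion of A linear. *)
Section SymmetricAlgebra.
Variables (k : comPzSemiRingType) (A : lSemiModType k).

Inductive sterm : Type :=
  | SGen of A
  | SZero
  | SAdd of sterm & sterm
  | SScale of k & sterm
  | SOne
  | SMul of sterm & sterm.

Inductive seqv : sterm -> sterm -> Prop :=
  | seqv_refl t : seqv t t
  | seqv_sym t u : seqv t u -> seqv u t
  | seqv_trans t u v : seqv t u -> seqv u v -> seqv t v
  | seqv_add t t' u u' :
      seqv t t' -> seqv u u' -> seqv (SAdd t u) (SAdd t' u')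
  | seqv_scale a t t' : seqv t t' -> seqv (SScale a t) (SScale a t')
  | seqv_mul t t' u u' :
      seqv t t' -> seqv u u' -> seqv (SMul t u) (SMul t' u')
  | seqv_addA t u v : seqv (SAdd t (SAdd u v)) (SAdd (SAdd t u) v)
  | seqv_addC t u : seqv (SAdd t u) (SAdd u t)
  | seqv_add0 t : seqv (SAdd SZero t) t
  | seqv_scaleA a b t : seqv (SScale a (SScale b t)) (SScale (a * b) t)
  | seqv_scale0 t : seqv (SScale 0 t) SZero
  | seqv_scale1 t : seqv (SScale 1 t) t
  | seqv_scaleDr a t u :
      seqv (SScale a (SAdd t u)) (SAdd (SScale a t) (SScale a u))
  | seqv_scaleDl a b t :
      seqv (SScale (a + b) t) (SAdd (SScale a t) (SScale b t))
  | seqv_mulA t u v : seqv (SMul t (SMul u v)) (SMul (SMul t u) v)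
  | seqv_mulC t u : seqv (SMul t u) (SMul u t)
  | seqv_mul1 t : seqv (SMul SOne t) t
  | seqv_mulDl t u v : seqv (SMul (SAdd t u) v) (SAdd (SMul t v) (SMul u v))
  | seqv_mul0 t : seqv (SMul SZero t) SZero
  | seqv_scaleAl a t u : seqv (SScale a (SMul t u)) (SMul (SScale a t) u)
  | seqv_genD x y : seqv (SGen (x + y)) (SAdd (SGen x) (SGen y))
  | seqv_genZ a x : seqv (SGen (a *: x)) (SScale a (SGen x)).

HB.instance Definition _ := gen_eqMixin sterm.
HB.instance Definition _ := gen_choiceMixin sterm.

Definition seqvb (t u : sterm) : bool := `[< seqv t u >].

Lemma seqvb_equiv : equiv_class_of seqvb.
Proof.
split=> [t|t u|t u v].
- exact/asboolP/seqv_refl.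
- by apply/asboolP/asboolP; exact: seqv_sym.
- by move=> /asboolP ut /asboolP tv; apply/asboolP/(seqv_trans ut tv).
Qed.
Canonical seqvb_equiv_rel := EquivRelPack seqvb_equiv.

Definition Sym : Type := {eq_quot seqvb}.
HB.instance Definition _ := Choice.on Sym.

Definition Spi (t : sterm) : Sym := \pi_({eq_quot seqvb}) t.

Lemma SpiP t u : Spi t = Spi u <-> seqv t u.
Proof.
split=> [/eqP|tu]; first by rewrite eqmodE => /asboolP.
by apply/eqP; rewrite eqmodE; apply/asboolP.
Qed.

Lemma Srepr (x : Sym) : Spi (repr x) = x.
Proof. exact: reprK. Qed.

Lemma SymW (P : Sym -> Prop) : (forall t, P (Spi t)) -> forall x, P x.
Proof. by move=> PS x; rewrite -[x]Srepr. Qed.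

Lemma repr_seqv t : seqv (repr (Spi t)) t.
Proof. exact/SpiP/Srepr. Qed.

Definition Sadd (x y : Sym) : Sym := Spi (SAdd (repr x) (repr y)).
Definition Smul (x y : Sym) : Sym := Spi (SMul (repr x) (repr y)).
Definition Sscale a (x : Sym) : Sym := Spi (SScale a (repr x)).

Lemma SaddE t u : Sadd (Spi t) (Spi u) = Spi (SAdd t u).
Proof. by apply/SpiP/seqv_add; exact: repr_seqv. Qed.
Lemma SmulE t u : Smul (Spi t) (Spi u) = Spi (SMul t u).
Proof. by apply/SpiP/seqv_mul; exact: repr_seqv. Qed.
Lemma SscaleE a t : Sscale a (Spi t) = Spi (SScale a t).
Proof. by apply/SpiP/seqv_scale; exact: repr_seqv. Qed.

Lemma SaddA : associative Sadd.
Proof.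
elim/SymW=> t; elim/SymW=> u; elim/SymW=> v; rewrite !SaddE.
exact/SpiP/seqv_addA.
Qed.
Lemma SaddC : commutative Sadd.
Proof. by elim/SymW=> t; elim/SymW=> u; rewrite !SaddE; exact/SpiP/seqv_addC. Qed.
Lemma Sadd0 : left_id (Spi SZero) Sadd.
Proof. by elim/SymW=> t; rewrite SaddE; exact/SpiP/seqv_add0. Qed.
HB.instance Definition _ := GRing.isNmodule.Build Sym SaddA SaddC Sadd0.

Lemma SmulA : associative Smul.
Proof.
elim/SymW=> t; elim/SymW=> u; elim/SymW=> v; rewrite !SmulE.
exact/SpiP/seqv_mulA.
Qed.
Lemma SmulC : commutative Smul.
Proof. by elim/SymW=> t; elim/SymW=> u; rewrite !SmulE; exact/SpiP/seqv_mulC. Qed.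
Lemma Smul1 : left_id (Spi SOne) Smul.
Proof. by elim/SymW=> t; rewrite SmulE; exact/SpiP/seqv_mul1. Qed.
Lemma SmulDl : left_distributive Smul +%R.
Proof.
elim/SymW=> t; elim/SymW=> u; elim/SymW=> v.
rewrite {1}/+%R /= SaddE !SmulE {1}/+%R /= SaddE.
exact/SpiP/seqv_mulDl.
Qed.
Lemma Smul0 : left_zero 0 Smul.
Proof. by elim/SymW=> t; rewrite {1}/0%R /= SmulE; exact/SpiP/seqv_mul0. Qed.
HB.instance Definition _ :=
  GRing.Nmodule_isComPzSemiRing.Build Sym SmulA SmulC Smul1 SmulDl Smul0.

Lemma SscaleA a b x : Sscale a (Sscale b x) = Sscale (a * b) x.
Proof. by elim/SymW: x => t; rewrite !SscaleE; exact/SpiP/seqv_scaleA. Qed.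
Lemma Sscale0 x : Sscale 0 x = 0.
Proof. by elim/SymW: x => t; rewrite SscaleE; exact/SpiP/seqv_scale0. Qed.
Lemma Sscale1 : left_id 1 Sscale.
Proof. by elim/SymW=> t; rewrite SscaleE; exact/SpiP/seqv_scale1. Qed.
Lemma SscaleDr : right_distributive Sscale +%R.
Proof.
move=> a; elim/SymW=> t; elim/SymW=> u.
rewrite {1}/+%R /= SaddE !SscaleE {1}/+%R /= SaddE.
exact/SpiP/seqv_scaleDr.
Qed.
Lemma SscaleDl x : {morph Sscale^~ x : a b / a + b}.
Proof.
elim/SymW: x => t a b; rewrite !SscaleE [RHS]SaddE.
exact/SpiP/seqv_scaleDl.
Qed.
HB.instance Definition _ := GRing.Nmodule_isLSemiModule.Build k Sym
  SscaleA Sscale0 Sscale1 SscaleDr SscaleDl.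

(* With this lemma Sym is a commutative k-algebra. The algebra structures of
   the library are not used because they require 1 != 0, which fails when k is
   the zero rig. *)
Lemma Sym_scaleAl a (x y : Sym) : a *: (x * y) = (a *: x) * y.
Proof.
elim/SymW: x => t; elim/SymW: y => u.
rewrite {1}/*%R {1}/*:%R /= SmulE SscaleE {1}/*%R {1}/*:%R /= SscaleE SmulE.
exact/SpiP/seqv_scaleAl.
Qed.

Definition Sgen (x : A) : Sym := Spi (SGen x).

Lemma Sgen_linear : is_linear Sgen.
Proof.
split=> [a x|x y]; rewrite /Sgen.
  by rewrite [RHS]SscaleE; exact/SpiP/seqv_genZ.
by rewrite [RHS]SaddE; exact/SpiP/seqv_genD.
Qed.

(* A linear map out of Sym A amounts to a family of symmetric multilinear
   maps, packaged here as a single function of lists. *)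
Definition sym_multi (B : lSemiModType k) (phi : seq A -> B) : Prop :=
  (forall s t, perm_eq s t -> phi s = phi t) /\
  (forall s, is_linear (fun x => phi (x :: s))).

Fixpoint seval (B : lSemiModType k) (t : sterm) (phi : seq A -> B) : B :=
  match t with
  | SGen x => phi [:: x]
  | SZero => 0
  | SAdd t u => seval t phi + seval u phi
  | SScale a t => a *: seval t phi
  | SOne => phi [::]
  | SMul t u => seval t (fun s => seval u (fun s' => phi (s ++ s')))
  end.

Section SymLift.
Variable B : lSemiModType k.
Implicit Types phi psi : seq A -> B.

Lemma eq_seval t phi psi : phi =1 psi -> seval t phi = seval t psi.
Proof. by move=> /funext ->. Qed.

Lemma sevalD t phi psi :
  seval t (fun s => phi s + psi s) = seval t phi + seval t psi.
Proof.
elim: t phi psi => //= [phi psi|t IHt u IHu phi psi|a t IHt phi psi|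
  t IHt u IHu phi psi]; first by rewrite addr0.
- by rewrite IHt IHu addrACA.
- by rewrite IHt scalerDr.
- by rewrite -IHt; apply: eq_seval => s.
Qed.

Lemma seval0 t : seval t (fun _ => 0 : B) = 0.
Proof.
elim: t => //= [t -> u ->|a t ->|t IHt u IHu]; rewrite ?addr0 ?scaler0 //.
by rewrite -[RHS]IHt; apply: eq_seval.
Qed.

Lemma sevalZ t a phi : seval t (fun s => a *: phi s) = a *: seval t phi.
Proof.
elim: t phi => //= [phi|t IHt u IHu phi|b t IHt phi|t IHt u IHu phi].
- by rewrite scaler0.
- by rewrite IHt IHu scalerDr.
- by rewrite IHt !scalerA mulrC.
- by rewrite -IHt; apply: eq_seval => s.
Qed.

Lemma seval_swap t u (phi : seq A -> seq A -> B) :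
  seval t (fun s => seval u (phi s)) = seval u (fun s' => seval t (phi^~ s')).
Proof.
elim: t phi => //= [phi|t IHt v IHv phi|a t IHt phi|t IHt v IHv phi].
- by rewrite seval0.
- by rewrite IHt IHv sevalD.
- by rewrite IHt sevalZ.
- rewrite -[RHS](IHt (fun s s' => seval v (fun s0 => phi (s ++ s0) s'))).
  by apply: eq_seval => s; rewrite IHv.
Qed.

Lemma sym_multi_cat phi s : sym_multi phi -> sym_multi (fun s' => phi (s ++ s')).
Proof.
move=> [phiP phiL]; split=> [s1 s2 s12|s']; first by apply: phiP; rewrite perm_cat2l.
have := phiL (s ++ s'); congr is_linear; apply/funext => x.
by apply: phiP; rewrite -cat1s perm_catCA.
Qed.

Lemma sym_multi_seval u phi :
  sym_multi phi -> sym_multi (fun s => seval u (fun s' => phi (s ++ s'))).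
Proof.
move=> phiM; have [phiP phiL] := phiM; split=> [s t st|s].
  by apply: eq_seval => s'; apply: phiP; rewrite perm_cat2r.
split=> [a x|x y].
  by rewrite -sevalZ; apply: eq_seval => s' /=; rewrite (phiL _).1.
by rewrite -sevalD; apply: eq_seval => s' /=; rewrite (phiL _).2.
Qed.

Lemma seval_seqv t u : seqv t u -> forall phi, sym_multi phi ->
  seval t phi = seval u phi.
Proof.
elim=> {t u} //=.
- by move=> t u _ IH phi phiM; rewrite IH.
- by move=> t u v _ IHt _ IHu phi phiM; rewrite IHt // IHu.
- by move=> t t' u u' _ IHt _ IHu phi phiM; rewrite IHt // IHu.
- by move=> a t t' _ IHt phi phiM; rewrite IHt.
- move=> t t' u u' _ IHt _ IHu phi phiM; rewrite IHt; last exact: sym_multi_seval.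
  by apply: eq_seval => s; apply: IHu; exact: sym_multi_cat.
- by move=> t u v phi _; rewrite addrA.
- by move=> t u phi _; rewrite addrC.
- by move=> t phi _; rewrite add0r.
- by move=> a b t phi _; rewrite scalerA.
- by move=> t phi _; rewrite scale0r.
- by move=> t phi _; rewrite scale1r.
- by move=> a t u phi _; rewrite scalerDr.
- by move=> a b t phi _; rewrite scalerDl.
- move=> t u v phi _; apply: eq_seval => s; apply: eq_seval => s'.
  by apply: eq_seval => s''; rewrite catA.
- move=> t u phi [phiP _]; rewrite seval_swap; apply: eq_seval => s.
  by apply: eq_seval => s'; apply: phiP; rewrite perm_catC.
- by move=> x y phi [_ phiL]; rewrite (phiL [::]).2.
- by move=> a x phi [_ phiL]; rewrite (phiL [::]).1.
Qed.

Definition Sym_lift phi (x : Sym) : B := seval (repr x) phi.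

Lemma Sym_liftE phi t : sym_multi phi -> Sym_lift phi (Spi t) = seval t phi.
Proof. by move=> phiM; apply: seval_seqv => //; exact: repr_seqv. Qed.

Lemma Sym_lift_linear phi : sym_multi phi -> is_linear (Sym_lift phi).
Proof.
move=> phiM; split=> [a|]; first elim/SymW=> t.
  by rewrite {1}/*:%R /= SscaleE !Sym_liftE.
elim/SymW=> t; elim/SymW=> u.
by rewrite {1}/+%R /= SaddE !Sym_liftE.
Qed.

Lemma Sym_lift_gen phi s :
  sym_multi phi -> Sym_lift phi (\prod_(x <- s) Sgen x) = phi s.
Proof.
elim: s phi => [|x s IHs] phi phiM; first by rewrite big_nil [LHS]Sym_liftE.
have phiM' := sym_multi_cat [:: x] phiM; rewrite -[RHS](IHs _ phiM') big_cons.
elim/SymW: (\prod_(_ <- s) _) => t.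
by rewrite {1}/*%R /= SmulE !Sym_liftE.
Qed.

Lemma Sym_ext (f g : Sym -> B) : is_linear f -> is_linear g ->
  (forall s, f (\prod_(x <- s) Sgen x) = g (\prod_(x <- s) Sgen x)) ->
  f =1 g.
Proof.
move=> fL gL fg; elim/SymW=> t; elim: t f g fL gL fg
  => [x||t IHt u IHu|a t IHt||t IHt u IHu] f g fL gL fg.
- by have := fg [:: x]; rewrite big_seq1.
- by rewrite [LHS](is_linear0 fL) [RHS](is_linear0 gL).
- by rewrite -SaddE [LHS]fL.2 [RHS]gL.2 (IHt f g) // (IHu f g).
- by rewrite -SscaleE [LHS]fL.1 [RHS]gL.1 (IHt f g).
- by have := fg [::]; rewrite big_nil.
rewrite -SmulE; change (f (Spi t * Spi u) = g (Spi t * Spi u)).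
have mulL (v : Sym) (h : Sym -> B) : is_linear h ->
    is_linear (fun w : Sym => h (w * v)).
  move=> [hZ hD]; split=> [a w|w w']; first by rewrite -Sym_scaleAl hZ.
  by rewrite mulrDl hD.
apply: (IHt (fun w => f (w * Spi u)) (fun w => g (w * Spi u)));
  [exact: mulL | exact: mulL |] => s.
rewrite mulrC; apply: (IHu (fun w => f (w * _)) (fun w => g (w * _)));
  [exact: mulL | exact: mulL |] => s'.
by rewrite -big_cat; exact: fg.
Qed.

End SymLift.
End SymmetricAlgebra.

Section DirectSum.
Variables (k : comPzSemiRingType) (I : choiceType) (M : lSemiModType k).

Definition dsum : Type := {fsfun I -> M with 0}.
HB.instance Definition _ := Choice.on dsum.

Definition dcoef (u : dsum) (i : I) : M := fun_of_fsfun u i.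

Lemma dsumP (u v : dsum) : (forall i, dcoef u i = dcoef v i) -> u = v.
Proof. by move=> uv; apply/fsfunP. Qed.

Definition dzero : dsum := [fsfun with 0].
Definition dadd (u v : dsum) : dsum :=
  [fsfun i in (finsupp u `|` finsupp v)%fset => dcoef u i + dcoef v i].
Definition dscale (a : k) (u : dsum) : dsum :=
  [fsfun i in finsupp u => a *: dcoef u i].

Lemma dzeroE i : dcoef dzero i = 0.
Proof. exact: fsfun0E. Qed.
Lemma daddE u v i : dcoef (dadd u v) i = dcoef u i + dcoef v i.
Proof.
rewrite /dcoef fsfun_fun in_fsetU.
by case: ifPn => //; rewrite negb_or => /andP[ui vi]; rewrite !fsfun_dflt ?addr0.
Qed.
Lemma dscaleE a u i : dcoef (dscale a u) i = a *: dcoef u i.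
Proof.
by rewrite /dcoef fsfun_fun; case: ifPn => // ui; rewrite fsfun_dflt ?scaler0.
Qed.

Lemma daddA : associative dadd.
Proof. by move=> u v w; apply/dsumP => i; rewrite !daddE addrA. Qed.
Lemma daddC : commutative dadd.
Proof. by move=> u v; apply/dsumP => i; rewrite !daddE addrC. Qed.
Lemma dadd0 : left_id dzero dadd.
Proof. by move=> u; apply/dsumP => i; rewrite daddE dzeroE add0r. Qed.
HB.instance Definition _ := GRing.isNmodule.Build dsum daddA daddC dadd0.

Lemma dscaleA a b u : dscale a (dscale b u) = dscale (a * b) u.
Proof. by apply/dsumP => i; rewrite !dscaleE scalerA. Qed.
Lemma dscale0 u : dscale 0 u = 0.
Proof. by apply/dsumP => i; rewrite dscaleE dzeroE scale0r. Qed.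
Lemma dscale1 : left_id 1 dscale.
Proof. by move=> u; apply/dsumP => i; rewrite dscaleE scale1r. Qed.
Lemma dscaleDr : right_distributive dscale +%R.
Proof. by move=> a u v; apply/dsumP => i; rewrite !(dscaleE, daddE) scalerDr. Qed.
Lemma dscaleDl u : {morph dscale^~ u : a b / a + b}.
Proof. by move=> a b; apply/dsumP => i; rewrite !(dscaleE, daddE) scalerDl. Qed.
HB.instance Definition _ := GRing.Nmodule_isLSemiModule.Build k dsum
  dscaleA dscale0 dscale1 dscaleDr dscaleDl.

Lemma dcoef_linear i : is_linear (dcoef^~ i).
Proof. by split=> [a u|u v]; [exact: dscaleE | exact: daddE]. Qed.

Definition dinj (i : I) (m : M) : dsum := [fsfun j in [fset i]%fset => m].

Lemma dinjE i m j : dcoef (dinj i m) j = if j == i then m else 0.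
Proof. by rewrite /dcoef fsfun_fun in_fset1. Qed.

Lemma dinj_linear i : is_linear (dinj i).
Proof.
split=> [a m|m m']; apply/dsumP => j.
  by rewrite [RHS]dscaleE !dinjE; case: eqP; rewrite ?scaler0.
by rewrite [RHS]daddE !dinjE; case: eqP; rewrite ?addr0.
Qed.

Lemma dsum_sumE (J : Type) (r : seq J) (P : pred J) (F : J -> dsum) i :
  dcoef (\sum_(j <- r | P j) F j) i = \sum_(j <- r | P j) dcoef (F j) i.
Proof. exact: (is_linear_sum _ _ _ (dcoef_linear i)). Qed.

Lemma dsum_decomp (u : dsum) : u = \sum_(i <- finsupp u) dinj i (dcoef u i).
Proof.
apply/dsumP => i; rewrite dsum_sumE.
case: (finsuppP u i) => [iNu|iu]; last first.
  rewrite (bigD1_seq i) ?fset_uniq //= dinjE eqxx big1 ?addr0 // => j ji.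
  by rewrite dinjE eq_sym (negPf ji).
rewrite {1}/dcoef fsfun_dflt // big1_seq // => j /andP[_ ju].
by rewrite dinjE; case: eqP => // ij; rewrite ij ju in iNu.
Qed.

Variable B : lSemiModType k.

Definition dsum_lift (f : I -> M -> B) (u : dsum) : B :=
  \sum_(i <- finsupp u) f i (dcoef u i).

Lemma dsum_lift_widen (f : I -> M -> B) u (S : {fset I}) :
  (forall i, is_linear (f i)) -> (finsupp u `<=` S)%fset ->
  dsum_lift f u = \sum_(i <- S) f i (dcoef u i).
Proof.
move=> fL uS; rewrite /dsum_lift; apply: big_fset_incl => // i _ iNu.
by rewrite /dcoef fsfun_dflt // (is_linear0 (fL i)).
Qed.

Lemma dsum_lift_linear (f : I -> M -> B) :
  (forall i, is_linear (f i)) -> is_linear (dsum_lift f).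
Proof.
move=> fL; split=> [a u|u v].
  rewrite (@dsum_lift_widen _ _ (finsupp u)) //; last exact: finsupp_sub.
  by rewrite scaler_sumr; apply: eq_bigr => i _; rewrite dscaleE (fL i).1.
pose S := (finsupp u `|` finsupp v)%fset.
rewrite !(@dsum_lift_widen _ _ S) ?fsubsetUl ?fsubsetUr //; last first.
  exact: finsupp_sub.
by rewrite -big_split; apply: eq_bigr => i _; rewrite /= daddE (fL i).2.
Qed.

Lemma dsum_lift_inj (f : I -> M -> B) i m :
  (forall i, is_linear (f i)) -> dsum_lift f (dinj i m) = f i m.
Proof.
move=> fL; rewrite (@dsum_lift_widen _ _ [fset i]%fset) //; last first.
  exact: finsupp_sub.
by rewrite big_seq_fset1 dinjE eqxx.
Qed.

Lemma dsum_ext (f g : dsum -> B) : is_linear f -> is_linear g ->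
  (forall i m, f (dinj i m) = g (dinj i m)) -> f =1 g.
Proof.
move=> fL gL fg u; rewrite (dsum_decomp u) !is_linear_sum //.
by apply: eq_bigr => i _.
Qed.

End DirectSum.

(* The tensor product: terms for the module operations on generators a (x) b,
   modulo the least congruence that contains the axioms of k-modules and makes
   (x) bilinear. *)
Section TensorProduct.
Variables (k : comPzSemiRingType) (A B : lSemiModType k).

Inductive tterm : Type :=
  | TGen of A & B
  | TZero
  | TAdd of tterm & tterm
  | TScale of k & tterm.

Inductive teqv : tterm -> tterm -> Prop :=
  | teqv_refl t : teqv t t
  | teqv_sym t u : teqv t u -> teqv u t
  | teqv_trans t u v : teqv t u -> teqv u v -> teqv t v
  | teqv_add t t' u u' :
      teqv t t' -> teqv u u' -> teqv (TAdd t u) (TAdd t' u')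
  | teqv_scale a t t' : teqv t t' -> teqv (TScale a t) (TScale a t')
  | teqv_addA t u v : teqv (TAdd t (TAdd u v)) (TAdd (TAdd t u) v)
  | teqv_addC t u : teqv (TAdd t u) (TAdd u t)
  | teqv_add0 t : teqv (TAdd TZero t) t
  | teqv_scaleA a b t : teqv (TScale a (TScale b t)) (TScale (a * b) t)
  | teqv_scale0 t : teqv (TScale 0 t) TZero
  | teqv_scale1 t : teqv (TScale 1 t) t
  | teqv_scaleDr a t u :
      teqv (TScale a (TAdd t u)) (TAdd (TScale a t) (TScale a u))
  | teqv_scaleDl a b t :
      teqv (TScale (a + b) t) (TAdd (TScale a t) (TScale b t))
  | teqv_genDl x x' y : teqv (TGen (x + x') y) (TAdd (TGen x y) (TGen x' y))
  | teqv_genDr x y y' : teqv (TGen x (y + y')) (TAdd (TGen x y) (TGen x y'))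
  | teqv_genZl a x y : teqv (TGen (a *: x) y) (TScale a (TGen x y))
  | teqv_genZr a x y : teqv (TGen x (a *: y)) (TScale a (TGen x y)).

HB.instance Definition _ := gen_eqMixin tterm.
HB.instance Definition _ := gen_choiceMixin tterm.

Definition teqvb (t u : tterm) : bool := `[< teqv t u >].

Lemma teqvb_equiv : equiv_class_of teqvb.
Proof.
split=> [t|t u|t u v].
- exact/asboolP/teqv_refl.
- by apply/asboolP/asboolP; exact: teqv_sym.
- by move=> /asboolP ut /asboolP tv; apply/asboolP/(teqv_trans ut tv).
Qed.
Canonical teqvb_equiv_rel := EquivRelPack teqvb_equiv.

Definition tensor : Type := {eq_quot teqvb}.
HB.instance Definition _ := Choice.on tensor.

Definition Tpi (t : tterm) : tensor := \pi_({eq_quot teqvb}) t.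

Lemma TpiP t u : Tpi t = Tpi u <-> teqv t u.
Proof.
split=> [/eqP|tu]; first by rewrite eqmodE => /asboolP.
by apply/eqP; rewrite eqmodE; apply/asboolP.
Qed.

Lemma Trepr (x : tensor) : Tpi (repr x) = x.
Proof. exact: reprK. Qed.

Lemma tensorW (P : tensor -> Prop) : (forall t, P (Tpi t)) -> forall x, P x.
Proof. by move=> PS x; rewrite -[x]Trepr. Qed.

Lemma repr_teqv t : teqv (repr (Tpi t)) t.
Proof. exact/TpiP/Trepr. Qed.

Definition Tadd (x y : tensor) : tensor := Tpi (TAdd (repr x) (repr y)).
Definition Tscale a (x : tensor) : tensor := Tpi (TScale a (repr x)).

Lemma TaddE t u : Tadd (Tpi t) (Tpi u) = Tpi (TAdd t u).
Proof. by apply/TpiP/teqv_add; exact: repr_teqv. Qed.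
Lemma TscaleE a t : Tscale a (Tpi t) = Tpi (TScale a t).
Proof. by apply/TpiP/teqv_scale; exact: repr_teqv. Qed.

Lemma TaddA : associative Tadd.
Proof.
elim/tensorW=> t; elim/tensorW=> u; elim/tensorW=> v; rewrite !TaddE.
exact/TpiP/teqv_addA.
Qed.
Lemma TaddC : commutative Tadd.
Proof.
by elim/tensorW=> t; elim/tensorW=> u; rewrite !TaddE; exact/TpiP/teqv_addC.
Qed.
Lemma Tadd0 : left_id (Tpi TZero) Tadd.
Proof. by elim/tensorW=> t; rewrite TaddE; exact/TpiP/teqv_add0. Qed.
HB.instance Definition _ := GRing.isNmodule.Build tensor TaddA TaddC Tadd0.

Lemma TscaleA a b x : Tscale a (Tscale b x) = Tscale (a * b) x.
Proof. by elim/tensorW: x => t; rewrite !TscaleE; exact/TpiP/teqv_scaleA. Qed.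
Lemma Tscale0 x : Tscale 0 x = 0.
Proof. by elim/tensorW: x => t; rewrite TscaleE; exact/TpiP/teqv_scale0. Qed.
Lemma Tscale1 : left_id 1 Tscale.
Proof. by elim/tensorW=> t; rewrite TscaleE; exact/TpiP/teqv_scale1. Qed.
Lemma TscaleDr : right_distributive Tscale +%R.
Proof.
move=> a; elim/tensorW=> t; elim/tensorW=> u.
rewrite {1}/+%R /= TaddE !TscaleE {1}/+%R /= TaddE.
exact/TpiP/teqv_scaleDr.
Qed.
Lemma TscaleDl x : {morph Tscale^~ x : a b / a + b}.
Proof.
elim/tensorW: x => t a b; rewrite !TscaleE [RHS]TaddE.
exact/TpiP/teqv_scaleDl.
Qed.
HB.instance Definition _ := GRing.Nmodule_isLSemiModule.Build k tensor
  TscaleA Tscale0 Tscale1 TscaleDr TscaleDl.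

Definition tens (x : A) (y : B) : tensor := Tpi (TGen x y).

Lemma tens_bilinear : bilinear tens.
Proof.
split=> [x|y]; split=> [a z|z z']; rewrite /tens.
- by rewrite [RHS]TscaleE; exact/TpiP/teqv_genZr.
- by rewrite [RHS]TaddE; exact/TpiP/teqv_genDr.
- by rewrite [RHS]TscaleE; exact/TpiP/teqv_genZl.
- by rewrite [RHS]TaddE; exact/TpiP/teqv_genDl.
Qed.

Variable C : lSemiModType k.

Fixpoint teval (f : A -> B -> C) (t : tterm) : C :=
  match t with
  | TGen x y => f x y
  | TZero => 0
  | TAdd t u => teval f t + teval f u
  | TScale a t => a *: teval f t
  end.

Lemma teval_teqv f t u : bilinear f -> teqv t u -> teval f t = teval f u.
Proof.
move=> [fr fl]; elim=> {t u} //=.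
- by move=> t u v _ -> _ ->.
- by move=> t t' u u' _ -> _ ->.
- by move=> a t t' _ ->.
- by move=> t u v; rewrite addrA.
- by move=> t u; rewrite addrC.
- by move=> t; rewrite add0r.
- by move=> a b t; rewrite scalerA.
- by move=> t; rewrite scale0r.
- by move=> t; rewrite scale1r.
- by move=> a t u; rewrite scalerDr.
- by move=> a b t; rewrite scalerDl.
- by move=> x x' y; rewrite (fl y).2.
- by move=> x y y'; rewrite (fr x).2.
- by move=> a x y; rewrite (fl y).1.
- by move=> a x y; rewrite (fr x).1.
Qed.

Definition tensor_lift_fun f (x : tensor) : C := teval f (repr x).

Lemma tensor_lift_pi f t : bilinear f -> tensor_lift_fun f (Tpi t) = teval f t.
Proof. by move=> fB; apply: teval_teqv => //; exact: repr_teqv. Qed.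

Lemma tensor_lift_linear f : bilinear f -> is_linear (tensor_lift_fun f).
Proof.
move=> fB; split=> [a|]; elim/tensorW=> t.
  by rewrite {1}/*:%R /= TscaleE !tensor_lift_pi.
elim/tensorW=> u.
by rewrite {1}/+%R /= TaddE !tensor_lift_pi.
Qed.

Definition tensor_lift f (fB : bilinear f) : {linear tensor -> C} :=
  mklin (tensor_lift_linear fB).

Lemma tensor_liftE f (fB : bilinear f) x y : tensor_lift fB (tens x y) = f x y.
Proof. exact: tensor_lift_pi. Qed.

End TensorProduct.


Section TensorMap.
Variables (k : comPzSemiRingType) (A B C D : lSemiModType k).
Variables (f : {linear A -> C}) (g : {linear B -> D}).

Lemma tensor_map_bilinear : bilinear (fun x y => tens (f x) (g y)).
Proof.
have [tr tl] := tens_bilinear C D; split=> [x|y].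
  exact: is_linear_comp (tr (f x)) (linear_is_linear g).
exact: is_linear_comp (tl (g y)) (linear_is_linear f).
Qed.

Definition tensor_map : {linear tensor A B -> tensor C D} :=
  tensor_lift tensor_map_bilinear.

Lemma tensor_mapE x y : tensor_map (tens x y) = tens (f x) (g y).
Proof. exact: tensor_liftE. Qed.

End TensorMap.


Section Arguments.
Variable A : eqType.

(* The list x_{i_1}, ..., x_{i_s} for I = {i_1 < ... < i_s}. *)
Definition args (T : finType) (x : T -> A) (I : {set T}) : seq A :=
  [seq x i | i <- enum I].

Lemma args_imset (T T' : finType) (h : T' -> T) (x : T -> A) (I : {set T'}) :
  injective h -> perm_eq (args x (h @: I)) (args (x \o h) I).
Proof.
move=> hI; rewrite /args (map_comp x h); apply: perm_map; apply: uniq_perm.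
- exact: enum_uniq.
- by rewrite map_inj_uniq // enum_uniq.
move=> i; rewrite mem_enum; apply/imsetP/mapP => -[j jI ->]; exists j => //.
  by rewrite mem_enum.
by rewrite -mem_enum.
Qed.

Lemma enum_setD1_perm (T : finType) (i : T) (I : {set T}) :
  i \in I -> perm_eq (enum I) (i :: enum (I :\ i)).
Proof.
move=> iI; apply: uniq_perm; first exact: enum_uniq.
  by rewrite /= mem_enum !inE eqxx enum_uniq.
by move=> j; rewrite inE !mem_enum !inE; case: eqP => // ->.
Qed.

Lemma args_setD1 (T : finType) (x : T -> A) (i : T) (I : {set T}) :
  i \in I -> perm_eq (args x I) (x i :: args x (I :\ i)).
Proof. by move=> /enum_setD1_perm/(perm_map x). Qed.

Lemma eq_args (T : finType) (x y : T -> A) (I : {set T}) :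
  {in I, x =1 y} -> args x I = args y I.
Proof. by move=> xy; apply/eq_in_map => i; rewrite mem_enum => /xy. Qed.

End Arguments.

Section PartitionSums.
Variable k : comPzSemiRingType.

Section Composition.
Variables (A B C : lSemiModType k) (G : seq B -> C) (F : seq A -> B).

(* The sum of G [:: F x_{A_1}; ..; F x_{A_r}] over the unordered partitions
   A_1 | .. | A_r of T into non-empty subsets. The blocks are listed in an
   arbitrary order, which is harmless as G is symmetric in all uses. *)
Definition part_sum (T : finType) (x : T -> A) : C :=
  \sum_(P : {set {set T}} | partition P [set: T])
    G [seq F (args x X) | X : {set T} <- enum P].

Hypotheses (GM : sym_multi G) (FM : sym_multi F).

Lemma part_sum_bij (T T' : finType) (h : T' -> T) (x : T -> A) :
  bijective h -> part_sum (x \o h) = part_sum x.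
Proof.
move=> hB; have hI := bij_inj hB; case: (hB) => g hK gK.
have imK (U V : finType) (a : U -> V) (b : V -> U) : cancel a b ->
    cancel (fun X : {set U} => a @: X) (fun X : {set V} => b @: X).
  move=> ab X; rewrite -imset_comp -[RHS]imset_id.
  by apply: eq_imset => i /=.
pose hh (X : {set T'}) : {set T} := h @: X.
pose H (P : {set {set T'}}) : {set {set T}} := hh @: P.
have HB : bijective H.
  exists (fun P : {set {set T}} => (fun X : {set T} => g @: X) @: P).
    by apply/imK/imK.
  by apply/imK/imK.
rewrite /part_sum [RHS](reindex H) /=; last exact: onW_bij.
have hT : [set: T] = h @: [set: T'].
  by apply/setP => i; rewrite inE -[i]gK imset_f.
apply: eq_big => [P|P _]; first by rewrite hT /H imset_partition.
have hhI : injective hh by apply: imset_inj.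
apply: GM.1; rewrite perm_sym.
apply: perm_trans (args_imset (fun X => F (args x X)) P hhI) _.
rewrite /args; have -> // : forall s t : seq B, s = t -> perm_eq s t.
  by move=> s _ <-.
by apply: eq_map => X /=; apply: FM.1; exact: args_imset.
Qed.

Lemma part_sum_cons_linear (s : seq A) :
  is_linear (fun a => part_sum (tnth (in_tuple (a :: s)))).
Proof.
rewrite /part_sum /=; apply: is_linear_bigsum => P partP.
pose x a : 'I_(size s).+1 -> A := tnth (in_tuple (a :: s)).
pose X0 := pblock P ord0.
have covP : ord0 \in cover P by rewrite (cover_partition partP) inE.
have X0P : X0 \in P by rewrite pblock_mem.
have iX0 : ord0 \in X0 by rewrite mem_pblock.
have x0 a b i : i != ord0 -> x a i = x b i.
  by rewrite /x !(tnth_nth 0) /=; case: i => -[].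
pose r := [seq F (args (x 0) X) | X : {set _} <- enum (P :\ X0)].
suff -> : (fun a => G [seq F (args (x a) X) | X : {set _} <- enum P]) =
          (fun b => G (b :: r)) \o F \o
          (fun a => a :: args (x 0) (X0 :\ ord0)).
  rewrite -compA; apply: is_linear_comp; first exact: GM.2.
  exact: FM.2.
apply/funext => a /=; apply: GM.1.
have := args_setD1 (fun X => F (args (x a) X)) X0P; rewrite {1}/args.
move=> /perm_trans; apply; rewrite -/r.
have -> : F (args (x a) X0) = F (a :: args (x 0) (X0 :\ ord0)).
  have -> : F (args (x a) X0) = F (x a ord0 :: args (x a) (X0 :\ ord0)).
    by apply: FM.1; exact: args_setD1.
  have -> : x a ord0 = a by rewrite /x (tnth_nth 0).
  congr (F (_ :: _)).
  by apply: eq_args => i; rewrite !inE => /andP[/x0 + _]; exact.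
rewrite /r /args perm_cons.
have -> // : forall s t : seq B, s = t -> perm_eq s t by move=> ? _ <-.
apply/eq_in_map => X; rewrite mem_enum !inE => /andP[XX0 XP].
congr F; apply: eq_args => i iX; apply: x0; apply: contraNneq XX0 => i0.
rewrite i0 in iX; apply/eqP; rewrite -(def_pblock _ XP iX) //.
exact: partition_trivIset partP.
Qed.

End Composition.

Lemma part_sum_sym_multi (A B C : lSemiModType k)
    (G : seq B -> C) (F : seq A -> B) :
  sym_multi G -> sym_multi F ->
  sym_multi (fun s : seq A => part_sum G F (tnth (in_tuple s))).
Proof.
move=> GM FM; split=> [s t|s]; last exact: part_sum_cons_linear.
move=> st; have /tuple_permP[p sp] : perm_eq s (in_tuple t) by [].
pose h i := p (cast_ord (perm_size st) i).
have hB : bijective h.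
  apply: bij_comp; first by exists (p^-1)%g; [exact: permK | exact: permKV].
  by exists (cast_ord (esym (perm_size st))); [exact: cast_ordK | exact: cast_ordKV].
rewrite -(part_sum_bij GM FM _ hB); congr part_sum; apply/funext => i /=.
rewrite (tnth_nth 0) /= {1}sp.
have -> : (i : nat) = cast_ord (perm_size st) i by [].
by rewrite -(tnth_nth 0 [tuple _ | _ < _]) tnth_mktuple.
Qed.

End PartitionSums.

Section SubsetSums.
Variables (k : comPzSemiRingType) (A B : lSemiModType k).
Variable H : seq A -> seq A -> B.

(* The sum over the subsets I of T of H x_I x_{T \ I}. *)
Definition subset_sum (T : finType) (x : T -> A) : B :=
  \sum_(X : {set T}) H (args x X) (args x (~: X)).

Hypotheses (HM1 : forall s, sym_multi (H^~ s)) (HM2 : forall s, sym_multi (H s)).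

Lemma subset_sum_bij (T T' : finType) (h : T' -> T) (x : T -> A) :
  bijective h -> subset_sum (x \o h) = subset_sum x.
Proof.
move=> hB; have hI := bij_inj hB; case: (hB) => g hK gK.
have HB : bijective (fun X : {set T'} => h @: X).
  by exists (fun X : {set T} => g @: X) => X;
    rewrite -imset_comp -[RHS]imset_id; apply: eq_imset => i /=.
rewrite /subset_sum [RHS](reindex (fun X : {set T'} => h @: X)) /=; last first.
  exact: onW_bij.
apply: eq_bigr => X _; have -> : ~: (h @: X) = h @: (~: X).
  apply/setP => i; rewrite inE -[i]gK !mem_imset // ?inE //.
rewrite ((HM1 _).1 _ _ (args_imset x X hI)).
by rewrite ((HM2 _).1 _ _ (args_imset x (~: X) hI)).
Qed.

Lemma subset_sum_sym_multi :
  sym_multi (fun s : seq A => subset_sum (tnth (in_tuple s))).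
Proof.
split=> [s t st|s].
  have /tuple_permP[p sp] : perm_eq s (in_tuple t) by [].
  pose h i := p (cast_ord (perm_size st) i).
  have hB : bijective h.
    apply: bij_comp; first by exists (p^-1)%g; [exact: permK | exact: permKV].
    by exists (cast_ord (esym (perm_size st)));
      [exact: cast_ordK | exact: cast_ordKV].
  rewrite -(subset_sum_bij _ hB); congr subset_sum; apply/funext => i /=.
  rewrite (tnth_nth 0) /= {1}sp.
  have -> : (i : nat) = cast_ord (perm_size st) i by [].
  by rewrite -(tnth_nth 0 [tuple _ | _ < _]) tnth_mktuple.
rewrite /subset_sum /=; apply: is_linear_bigsum => X _.
pose x a : 'I_(size s).+1 -> A := tnth (in_tuple (a :: s)).
have xa a : x a ord0 = a by rewrite /x (tnth_nth 0).
have x0 a b i : i != ord0 -> x a i = x b i.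
  by rewrite /x !(tnth_nth 0) /=; case: i => -[].
have [X0|X0] := boolP (ord0 \in X).
  suff -> : (fun a => H (args (x a) X) (args (x a) (~: X))) =
      (fun a => H (a :: args (x 0) (X :\ ord0)) (args (x 0) (~: X))).
    exact: (HM1 _).2.
  apply/funext => a; have aX : args (x a) (~: X) = args (x 0) (~: X).
    apply: eq_args => i; rewrite inE => iX; apply: x0.
    by apply: contraNneq iX => ->.
  rewrite aX ((HM1 _).1 _ _ (args_setD1 (x a) X0)) xa; congr (H (_ :: _) _).
  by apply: eq_args => i; rewrite !inE => /andP[/x0 + _]; exact.
have X0' : ord0 \in ~: X by rewrite inE.
suff -> : (fun a => H (args (x a) X) (args (x a) (~: X))) =
    (fun a => H (args (x 0) X) (a :: args (x 0) (~: X :\ ord0))).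
  exact: (HM2 _).2.
apply/funext => a; have aX : args (x a) X = args (x 0) X.
  by apply: eq_args => i iX; apply: x0; apply: contraNneq X0 => <-.
rewrite aX ((HM2 _).1 _ _ (args_setD1 (x a) X0')) xa; congr (H _ (_ :: _)).
by apply: eq_args => i; rewrite !inE => /andP[/x0 + _]; exact.
Qed.

End SubsetSums.

(* Maps A ~> B of Faa(k-Mod_w): families of functions f^(n) : A x A^n -> B,
   symmetric and multilinear in the last n variables. *)
Section FaaMaps.
Variable k : comPzSemiRingType.
Implicit Types A B C : lSemiModType k.

Record faa A B := Faa {
  faa_fun :> forall n, A -> n.-tuple A -> B;
  faa_sym : forall n x (t u : n.-tuple A),
    perm_eq t u -> faa_fun x t = faa_fun x u;
  faa_lin : forall n x (t : n.-tuple A) (i : 'I_n), is_linear (fun a =>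
    faa_fun x [tuple if j == i then a else tnth t j | j < n])
}.

(* [faa_at f x0 [:: x1; ..; xn]] is f^(n)(x0, x1, .., xn). *)
Definition faa_at A B (f : faa A B) (x : A) (s : seq A) : B :=
  f (size s) x (in_tuple s).

Lemma faa_atE A B (f : faa A B) n x (t : n.-tuple A) : f n x t = faa_at f x t.
Proof.
case: t => s /= sn; have := sn; rewrite -{1}(eqP sn) => sn'.
move: (sn); rewrite -(eqP sn) => {}sn; rewrite /faa_at; congr faa_fun.
exact: val_inj.
Qed.

Lemma faa_at_sym_multi A B (f : faa A B) x : sym_multi (faa_at f x).
Proof.
split=> [s t st|s].
  have st' : size s == size t by rewrite (perm_size st).
  have -> : faa_at f x s = f (size t) x (Tuple st') by rewrite faa_atE.
  exact: faa_sym.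
have := faa_lin f x (in_tuple (0 :: s)) ord0; congr is_linear.
apply/funext => a; rewrite faa_atE; congr faa_at; apply: (@eq_from_nth _ 0).
  by rewrite size_tuple.
move=> i; rewrite size_tuple => iS; rewrite -[i]/(nat_of_ord (Ordinal iS)).
rewrite -tnth_nth tnth_mktuple /=; case: i iS => //= i iS.
by rewrite (tnth_nth 0).
Qed.

Lemma faa_ext A B (f g : faa A B) :
  (forall x s, faa_at f x s = faa_at g x s) -> f = g.
Proof.
move=> fg; have fgE : f = g :> (forall n, A -> n.-tuple A -> B).
  apply/functional_extensionality_dep => n; apply/funext => x; apply/funext => t.
  by rewrite !faa_atE fg.
case: f g fgE {fg} => [f f1 f2] [g g1 g2] /= fg; subst g.
by rewrite (Prop_irrelevance f1 g1) (Prop_irrelevance f2 g2).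
Qed.

Section MkFaa.
Variables (A B : lSemiModType k) (phi : A -> seq A -> B).
Hypothesis phiM : forall x, sym_multi (phi x).

Lemma mkfaa_lin n x (t : n.-tuple A) (i : 'I_n) : is_linear (fun a =>
  phi x [tuple if j == i then a else tnth t j | j < n]).
Proof.
have := (phiM x).2 [seq tnth t j | j <- enum (setT :\ i)]; congr is_linear.
apply/funext => a; apply: (phiM x).1; rewrite perm_sym /=.
pose y j := if j == i then a else tnth t j.
have -> : [seq tnth t j | j <- enum (setT :\ i)] = args y (setT :\ i).
  apply/eq_in_map => j; rewrite mem_enum !inE /y.
  by case: eqP.
have := args_setD1 y (in_setT i); rewrite {1}/args.
have -> : y i = a by rewrite /y eqxx.
by have -> : enum [set: 'I_n] = enum 'I_n by apply: eq_enum => j; rewrite inE.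
Qed.

Definition mkfaa : faa A B :=
  Faa (fun n x t tu => (phiM x).1 t tu) mkfaa_lin.

Lemma mkfaaE x s : faa_at mkfaa x s = phi x s.
Proof. by []. Qed.

End MkFaa.

HB.instance Definition _ A B := gen_eqMixin (faa A B).
HB.instance Definition _ A B := gen_choiceMixin (faa A B).
End FaaMaps.

Section FaaOperations.
Variable k : comPzSemiRingType.
Implicit Types A B C : lSemiModType k.

Lemma sym_multi_add A B (phi psi : seq A -> B) :
  sym_multi phi -> sym_multi psi -> sym_multi (fun s => phi s + psi s).
Proof.
move=> [phiP phiL] [psiP psiL]; split=> [s t st|s].
  by rewrite (phiP _ _ st) (psiP _ _ st).
exact: is_linear_add.
Qed.

Lemma sym_multi_scale A B a (phi : seq A -> B) :
  sym_multi phi -> sym_multi (fun s => a *: phi s).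
Proof.
move=> [phiP phiL]; split=> [s t st|s]; first by rewrite (phiP _ _ st).
exact: is_linear_scale.
Qed.

Lemma sym_multi0 A B : sym_multi (fun _ : seq A => 0 : B).
Proof. by split=> // s; exact: is_linear_zero. Qed.

Definition faa_zero A B : faa A B := mkfaa (fun _ => sym_multi0 A B).
Definition faa_add A B (f g : faa A B) : faa A B :=
  mkfaa (fun x => sym_multi_add (faa_at_sym_multi f x) (faa_at_sym_multi g x)).
Definition faa_scale A B (a : k) (f : faa A B) : faa A B :=
  mkfaa (fun x => sym_multi_scale a (faa_at_sym_multi f x)).

Section Module.
Variables A B : lSemiModType k.
Lemma faa_addA : associative (@faa_add A B).
Proof. by move=> f g h; apply: faa_ext => x s; rewrite !mkfaaE addrA. Qed.
Lemma faa_addC : commutative (@faa_add A B).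
Proof. by move=> f g; apply: faa_ext => x s; rewrite !mkfaaE addrC. Qed.
Lemma faa_add0 : left_id (faa_zero A B) (@faa_add A B).
Proof. by move=> f; apply: faa_ext => x s; rewrite !mkfaaE add0r. Qed.
HB.instance Definition _ :=
  GRing.isNmodule.Build (faa A B) faa_addA faa_addC faa_add0.

Lemma faa_scaleA a b (f : faa A B) :
  faa_scale a (faa_scale b f) = faa_scale (a * b) f.
Proof. by apply: faa_ext => x s; rewrite !mkfaaE scalerA. Qed.
Lemma faa_scale0 (f : faa A B) : faa_scale 0 f = 0.
Proof. by apply: faa_ext => x s; rewrite !mkfaaE scale0r. Qed.
Lemma faa_scale1 : left_id 1 (@faa_scale A B).
Proof. by move=> f; apply: faa_ext => x s; rewrite !mkfaaE scale1r. Qed.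
Lemma faa_scaleDr : right_distributive (@faa_scale A B) +%R.
Proof. by move=> a f g; apply: faa_ext => x s; rewrite !mkfaaE scalerDr. Qed.
Lemma faa_scaleDl (f : faa A B) : {morph (@faa_scale A B)^~ f : a b / a + b}.
Proof. by move=> a b; apply: faa_ext => x s; rewrite !mkfaaE scalerDl. Qed.
HB.instance Definition _ := GRing.Nmodule_isLSemiModule.Build k (faa A B)
  faa_scaleA faa_scale0 faa_scale1 faa_scaleDr faa_scaleDl.
End Module.

(* A k-linear map f as a Faa map: f^(0) = f, f^(1) = f \o \pi_1, and
   f^(n) = 0 for n >= 2. Identities and projections are of this form. *)
Definition linear_faa_at A B (f : A -> B) (x : A) (s : seq A) : B :=
  match s with [::] => f x | [:: y] => f y | _ => 0 end.

Lemma linear_faa_sym_multi A B (f : A -> B) x :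
  is_linear f -> sym_multi (linear_faa_at f x).
Proof.
move=> fL; split=> [s t st|[|y s]] //=; last exact: is_linear_zero.
have := perm_size st; case: s t st => [|y [|y' s]] [|z [|z' t]] //= yz _.
by have := perm_mem yz z; rewrite !inE eqxx => /eqP ->.
Qed.

Definition linear_faa A B (f : {linear A -> B}) : faa A B :=
  mkfaa (fun x => linear_faa_sym_multi x (linear_is_linear f)).

Definition faa_id A : faa A A := linear_faa [the {linear A -> A} of idfun].
Definition faa_fst A B : faa (A * B)%type A :=
  linear_faa [the {linear (A * B)%type -> A} of fst].
Definition faa_snd A B : faa (A * B)%type B :=
  linear_faa [the {linear (A * B)%type -> B} of snd].

Definition faa_comp A B C (g : faa B C) (f : faa A B) : faa A C :=
  mkfaa (fun x => part_sum_sym_multi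
    (faa_at_sym_multi g (faa_at f x [::])) (faa_at_sym_multi f x)).

Lemma faa_pair_sym_multi A B C (f : faa A B) (g : faa A C) x :
  sym_multi (fun s => (faa_at f x s, faa_at g x s) : (B * C)%type).
Proof.
have [fP fL] := faa_at_sym_multi f x; have [gP gL] := faa_at_sym_multi g x.
split=> [s t st|s]; first by rewrite (fP _ _ st) (gP _ _ st).
split=> [a y|y z]; first by rewrite (fL s).1 (gL s).1.
by rewrite (fL s).2 (gL s).2.
Qed.

Definition faa_pair A B C (f : faa A B) (g : faa A C) : faa A (B * C)%type :=
  mkfaa (faa_pair_sym_multi f g).

(* The differential: for x = (x0, y0) and s = [:: (x1, y1); ..; (xn, yn)],
     f^(n+1)(x0, .., xn, y0) + \sum_i f^(n)(x0, .., y_i, .., xn),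
   where in the i-th summand y_i replaces x_i. *)
Definition subst_sum A B (phi : seq A -> B) (s : seq (A * A)) : B :=
  \sum_(i < size s) phi (set_nth 0 (map fst s) i (nth 0 s i).2).

Definition faa_D_at A B (f : faa A B) (x : A * A) (s : seq (A * A)) : B :=
  faa_at f x.1 (rcons (map fst s) x.2) + subst_sum (faa_at f x.1) s.

Lemma subst_sum_cons A B (phi : seq A -> B) z s :
  subst_sum phi (z :: s) =
  phi (z.2 :: map fst s) + subst_sum (fun s' => phi (z.1 :: s')) s.
Proof. by rewrite /subst_sum big_ord_recl. Qed.

Lemma subst_sum_cat A B (phi : seq A -> B) s t :
  subst_sum phi (s ++ t) = subst_sum (fun s' => phi (s' ++ map fst t)) s +
                           subst_sum (fun t' => phi (map fst s ++ t')) t.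
Proof.
elim: s phi => [|z s IHs] phi; first by rewrite {2}/subst_sum big_ord0 add0r.
by rewrite /= !subst_sum_cons IHs map_cat addrA.
Qed.

Lemma eq_subst_sum A B (phi psi : seq A -> B) s :
  phi =1 psi -> subst_sum phi s = subst_sum psi s.
Proof. by move=> /funext ->. Qed.

Lemma subst_sum_linear A B (phi : seq A -> B) s :
  sym_multi phi -> is_linear (fun z => subst_sum phi (z :: s)).
Proof.
move=> phiM.
suff: is_linear (fun z : A * A => phi (z.2 :: map fst s) +
    subst_sum (fun s' => phi (z.1 :: s')) s).
  by congr is_linear; apply/funext => z; rewrite subst_sum_cons.
apply: is_linear_add.
  by apply: (is_linear_comp (phiM.2 _)); exact: (linear_is_linear snd).
apply: is_linear_bigsum => i _.
by apply: (is_linear_comp (phiM.2 _)); exact: (linear_is_linear fst).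
Qed.

Lemma subst_sum_sym_multi A B (phi : seq A -> B) :
  sym_multi phi -> sym_multi (subst_sum phi).
Proof.
move=> phiM; split=> [s t st|s]; last exact: subst_sum_linear.
pose P u := subst_sum phi s = subst_sum phi u.
apply: (catCA_perm_ind (P := P)) st _; rewrite /P // => s1 s2 s3 ->.
rewrite !subst_sum_cat addrCA; congr (_ + _); last congr (_ + _);
  by apply: eq_subst_sum => u; rewrite ?map_cat; apply: phiM.1; rewrite perm_catCA.
Qed.

Lemma faa_D_sym_multi A B (f : faa A B) x : sym_multi (faa_D_at f x).
Proof.
have fM := faa_at_sym_multi f x.1; apply: sym_multi_add; last first.
  exact: subst_sum_sym_multi.
split=> [s t st|s].
  by apply: fM.1; rewrite -!cats1 perm_cat2r; exact: perm_map.
rewrite /=; apply: (is_linear_comp (fM.2 _)).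
exact: (linear_is_linear fst).
Qed.

Definition faa_D A B (f : faa A B) : faa (A * A)%type B :=
  mkfaa (faa_D_sym_multi f).

End FaaOperations.

Section ModalityQ.
Variable k : comPzSemiRingType.
Implicit Types A B C : lSemiModType k.

Definition Q A : lSemiModType k := dsum A (Sym A).

(* [bra x0 [:: x1; ..; xn]] is <x0, x1, .., xn>. *)
Definition bra A (x : A) (s : seq A) : Q A := dinj x (\prod_(y <- s) Sgen y).

Lemma bra_sym_multi A (x : A) : sym_multi (bra x).
Proof.
split=> [s t st|s]; first by rewrite /bra (perm_big _ st).
have mulL (m : Sym A) : is_linear (fun m' : Sym A => m' * m).
  by split=> [a u|u v]; rewrite ?Sym_scaleAl ?mulrDl.
have := is_linear_comp (@dinj_linear k A (Sym A) x)
  (is_linear_comp (mulL (\prod_(y <- s) Sgen y)) (@Sgen_linear _ A)).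
by congr is_linear; apply/funext => y; rewrite /bra big_cons.
Qed.

Definition Qlift_fun A B (f : faa A B) : Q A -> B :=
  dsum_lift (fun x => Sym_lift (faa_at f x)).

Lemma Qlift_linear A B (f : faa A B) : is_linear (Qlift_fun f).
Proof.
apply: dsum_lift_linear => x; apply: Sym_lift_linear; exact: faa_at_sym_multi.
Qed.

(* The linear map out of Q A that sends <x0, .., xn> to f^(n)(x0, .., xn). *)
Definition Qlift A B (f : faa A B) : {linear Q A -> B} :=
  mklin (Qlift_linear f).

Lemma Qlift_bra A B (f : faa A B) x s : Qlift f (bra x s) = faa_at f x s.
Proof.
rewrite /Qlift /= /Qlift_fun dsum_lift_inj; last first.
  by move=> y; apply: Sym_lift_linear; exact: faa_at_sym_multi.
by rewrite Sym_lift_gen //; exact: faa_at_sym_multi.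
Qed.

Lemma Q_ext A B (f g : Q A -> B) : is_linear f -> is_linear g ->
  (forall x s, f (bra x s) = g (bra x s)) -> f =1 g.
Proof.
move=> fL gL fg; apply: (dsum_ext fL gL) => x.
apply: Sym_ext => [||s]; last exact: fg.
- exact: is_linear_comp fL (@dinj_linear k A (Sym A) x).
- exact: is_linear_comp gL (@dinj_linear k A (Sym A) x).
Qed.

Lemma Qmap_sym_multi A B (f : {linear A -> B}) x :
  sym_multi (fun s => bra (f x) (map f s)).
Proof.
have bM := bra_sym_multi (f x); split=> [s t st|s].
  exact/bM.1/perm_map.
exact: is_linear_comp (bM.2 _) (linear_is_linear f).
Qed.

Definition Qmap A B (f : {linear A -> B}) : {linear Q A -> Q B} :=
  Qlift (mkfaa (Qmap_sym_multi f)).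

(* Counit: <x0> |-> x0, <x0, x1> |-> x1 and <x0, .., xn> |-> 0 for n >= 2. *)
Definition Qeps A : {linear Q A -> A} := Qlift (faa_id A).

(* Comultiplication: the sum over the partitions A_1 | .. | A_r of {1, .., n}
   of < <x0>, <x_{A_1}>, .., <x_{A_r}> >. *)
Definition Qdelta A : {linear Q A -> Q (Q A)} :=
  Qlift (mkfaa (fun x => part_sum_sym_multi
    (bra_sym_multi (bra x [::])) (bra_sym_multi x))).

Lemma tens_bra_sym_multi A (x : A) s :
  sym_multi (fun t => tens (bra x t) (bra x s)) /\
  sym_multi (fun t => tens (bra x s) (bra x t)).
Proof.
have bM := bra_sym_multi x; have [tr tl] := tens_bilinear (Q A) (Q A).
split; split=> [t u tu|t]; rewrite ?(bM.1 _ _ tu) //.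
  exact: is_linear_comp (tl _) (bM.2 _).
exact: is_linear_comp (tr _) (bM.2 _).
Qed.

(* Comonoid comultiplication: the sum over the subsets I of {1, .., n} of
   <x_I> (x) <x_{[n] \ I}>. *)
Definition QDelta A : {linear Q A -> tensor (Q A) (Q A)} :=
  Qlift (mkfaa (fun x => subset_sum_sym_multi
    (fun s => (tens_bra_sym_multi x s).1)
    (fun s => (tens_bra_sym_multi x s).2))).

Lemma Qder_sym_multi A (y x : A) : sym_multi (fun s => bra x (rcons s y)).
Proof.
have bM := bra_sym_multi x; split=> [s t st|s] /=; last exact: bM.2.
by apply: bM.1; rewrite -!cats1 perm_cat2r.
Qed.

Lemma Qder_bilinear A :
  bilinear (fun (u : Q A) y => Qlift (mkfaa (Qder_sym_multi y)) u).
Proof.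
split=> [u|y]; last exact: Qlift_linear.
have rL x s : is_linear (fun y : A => bra x (rcons s y)).
  have bM := bra_sym_multi x; have := bM.2 s; congr is_linear.
  apply/funext => y; apply: bM.1; rewrite perm_sym perm_rcons //.
split=> [a y|y z].
  apply: (Q_ext (g := fun u => a *: Qlift (mkfaa (Qder_sym_multi y)) u)).
  - exact: Qlift_linear.
  - exact/is_linear_scale/Qlift_linear.
  - by move=> x s; rewrite !Qlift_bra !mkfaaE (rL x s).1.
apply: (Q_ext (g := fun u => Qlift (mkfaa (Qder_sym_multi y)) u +
                             Qlift (mkfaa (Qder_sym_multi z)) u)).
- exact: Qlift_linear.
- by apply: is_linear_add; exact: Qlift_linear.
- by move=> x s; rewrite !Qlift_bra !mkfaaE (rL x s).2.
Qed.

(* The deriving transformation: <x0, .., xn> (x) y |-> <x0, .., xn, y>. *)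
Definition Qder A : {linear tensor (Q A) A -> Q A} :=
  tensor_lift (@Qder_bilinear A).

End ModalityQ.


(* The data of a cartesian left k-linear category, with chosen finite products,
   and of a differential operator; the axioms are in [is_cdc]. *)
Record cdc_data (k : comPzSemiRingType) := CdcData {
  ob : Type;
  hom : ob -> ob -> lSemiModType k;
  idm : forall A, hom A A;
  comp : forall A B C, hom B C -> hom A B -> hom A C;
  one : ob;
  prd : ob -> ob -> ob;
  pr0 : forall A B, hom (prd A B) A;
  pr1 : forall A B, hom (prd A B) B;
  pairm : forall X A B, hom X A -> hom X B -> hom X (prd A B);
  diff : forall A B, hom A B -> hom (prd A A) B
}.

Arguments hom {k c} A B.
Arguments idm {k c} A.
Arguments comp {k c A B C} g f.
Arguments one {k} c.
Arguments prd {k c} A B.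
Arguments pr0 {k c} A B.
Arguments pr1 {k c} A B.
Arguments pairm {k c X A B} f g.
Arguments diff {k c A B} f.

Declare Scope cdc_scope.
Delimit Scope cdc_scope with cdc.
Local Open Scope cdc_scope.
Notation "g \oo f" := (comp g f)
  (at level 50, left associativity) : cdc_scope.

Record is_cdc (k : comPzSemiRingType) (C : cdc_data k) : Prop := {
  comp_id_l : forall (A B : ob C) (f : hom A B), idm B \oo f = f;
  comp_id_r : forall (A B : ob C) (f : hom A B), f \oo idm A = f;
  comp_assoc : forall (A B C' D : ob C)
      (h : hom C' D) (g : hom B C') (f : hom A B),
    h \oo (g \oo f) = (h \oo g) \oo f;
  comp_linear_l : forall (A B C' : ob C) (f : hom A B),
    is_linear (fun g : hom B C' => g \oo f);
  one_terminal : forall (A : ob C) (f g : hom A (one C)), f = g;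
  pr0_pair : forall (X A B : ob C) (f : hom X A) (g : hom X B),
    pr0 A B \oo pairm f g = f;
  pr1_pair : forall (X A B : ob C) (f : hom X A) (g : hom X B),
    pr1 A B \oo pairm f g = g;
  pair_eta : forall (X A B : ob C) (h : hom X (prd A B)),
    pairm (pr0 A B \oo h) (pr1 A B \oo h) = h;
  proj_linear : forall X A B : ob C, is_linear
    (fun h : hom X (prd A B) =>
       (pr0 A B \oo h, pr1 A B \oo h) : (hom X A * hom X B)%type);
  diff_linear : forall A B : ob C, is_linear (@diff k C A B);
  diff_linear2 : forall (X A B : ob C) (f : hom A B) (x : hom X A),
    is_linear (fun v : hom X A => diff f \oo pairm x v);
  diff_pr0 : forall A B : ob C,
    diff (pr0 A B) = pr0 A B \oo pr1 (prd A B) (prd A B);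
  diff_pr1 : forall A B : ob C,
    diff (pr1 A B) = pr1 A B \oo pr1 (prd A B) (prd A B);
  diff_id : forall A : ob C, diff (idm A) = pr1 A A;
  diff_comp : forall (A B C' : ob C) (g : hom B C') (f : hom A B),
    diff (g \oo f) = diff g \oo pairm (f \oo pr0 A A) (diff f);
  diff_diff_lin : forall (X A B : ob C) (f : hom A B) (x r v : hom X A),
    diff (diff f) \oo pairm (pairm x r) (pairm 0 v) = diff f \oo pairm x v;
  diff_diff_sym : forall (X A B : ob C) (f : hom A B) (x r s : hom X A),
    diff (diff f) \oo pairm (pairm x r) (pairm s 0) =
    diff (diff f) \oo pairm (pairm x s) (pairm r 0)
}.

Definition eq_hom (k : comPzSemiRingType) (C : cdc_data k) (A B : ob C)
    (e : A = B) : hom A B :=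
  match e in _ = B' return hom A B' with erefl => idm A end.

(* An isomorphism of categories that preserves the module structure on homs,
   the chosen finite products and the differential; the objects
   F (A * B) and F A * F B are identified along [iso_prd]. *)
Record cdc_iso (k : comPzSemiRingType) (C D : cdc_data k) := {
  iso_ob : ob C -> ob D;
  iso_hom : forall A B : ob C, hom A B -> hom (iso_ob A) (iso_ob B);
  iso_ob_bij : bijective iso_ob;
  iso_hom_bij : forall A B : ob C, bijective (@iso_hom A B);
  iso_id : forall A : ob C, iso_hom (idm A) = idm (iso_ob A);
  iso_comp : forall (A B C' : ob C) (g : hom B C') (f : hom A B),
    iso_hom (g \oo f) = iso_hom g \oo iso_hom f;
  iso_linear : forall A B : ob C, is_linear (@iso_hom A B);
  iso_one : iso_ob (one C) = one D;
  iso_prd : forall A B : ob C, iso_ob (prd A B) = prd (iso_ob A) (iso_ob B);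
  iso_pr0 : forall A B : ob C,
    iso_hom (pr0 A B) = pr0 (iso_ob A) (iso_ob B) \oo eq_hom (iso_prd A B);
  iso_pr1 : forall A B : ob C,
    iso_hom (pr1 A B) = pr1 (iso_ob A) (iso_ob B) \oo eq_hom (iso_prd A B);
  iso_diff : forall (A B : ob C) (f : hom A B),
    iso_hom (diff f) = diff (iso_hom f) \oo eq_hom (iso_prd A A)
}.

(* The zero module, as the module of vectors of length 0. *)
Definition zero_module (k : comPzSemiRingType) : lSemiModType k := 'rV[k]_0.

Definition prod_module (k : comPzSemiRingType) (A B : lSemiModType k) :
  lSemiModType k := (A * B)%type.

Definition Faa_cdc (k : comPzSemiRingType) : cdc_data k := {|
  ob := lSemiModType k;
  hom := fun A B => faa A B;
  idm := @faa_id k;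
  comp := @faa_comp k;
  one := zero_module k;
  prd := @prod_module k;
  pr0 := @faa_fst k;
  pr1 := @faa_snd k;
  pairm := @faa_pair k;
  diff := @faa_D k
|}.

Section CoKleisli.
Variable k : comPzSemiRingType.
Implicit Types A B C : lSemiModType k.

Definition kl A B : Type := {linear Q A -> B}.
HB.instance Definition _ A B := gen_eqMixin (kl A B).
HB.instance Definition _ A B := gen_choiceMixin (kl A B).

Definition kl_zero A B : kl A B := mklin (is_linear_zero (Q A) B).
Definition kl_add A B (f g : kl A B) : kl A B :=
  mklin (is_linear_add (linear_is_linear f) (linear_is_linear g)).
Definition kl_scale A B (a : k) (f : kl A B) : kl A B :=
  mklin (is_linear_scale a (linear_is_linear f)).

Section Module.
Variables A B : lSemiModType k.
Lemma kl_addA : associative (@kl_add A B).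
Proof. by move=> f g h; apply: lin_ext => u /=; rewrite addrA. Qed.
Lemma kl_addC : commutative (@kl_add A B).
Proof. by move=> f g; apply: lin_ext => u /=; rewrite addrC. Qed.
Lemma kl_add0 : left_id (kl_zero A B) (@kl_add A B).
Proof. by move=> f; apply: lin_ext => u /=; rewrite add0r. Qed.
HB.instance Definition _ :=
  GRing.isNmodule.Build (kl A B) kl_addA kl_addC kl_add0.

Lemma kl_scaleA a b (f : kl A B) : kl_scale a (kl_scale b f) = kl_scale (a * b) f.
Proof. by apply: lin_ext => u /=; rewrite scalerA. Qed.
Lemma kl_scale0 (f : kl A B) : kl_scale 0 f = 0.
Proof. by apply: lin_ext => u /=; rewrite scale0r. Qed.
Lemma kl_scale1 : left_id 1 (@kl_scale A B).
Proof. by move=> f; apply: lin_ext => u /=; rewrite scale1r. Qed.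
Lemma kl_scaleDr : right_distributive (@kl_scale A B) +%R.
Proof. by move=> a f g; apply: lin_ext => u /=; rewrite scalerDr. Qed.
Lemma kl_scaleDl (f : kl A B) : {morph (@kl_scale A B)^~ f : a b / a + b}.
Proof. by move=> a b; apply: lin_ext => u /=; rewrite scalerDl. Qed.
HB.instance Definition _ := GRing.Nmodule_isLSemiModule.Build k (kl A B)
  kl_scaleA kl_scale0 kl_scale1 kl_scaleDr kl_scaleDl.
End Module.

Definition kl_id A : kl A A := Qeps A.

Definition kl_comp A B C (g : kl B C) (f : kl A B) : kl A C :=
  [the {linear Q A -> C} of g \o (Qmap f \o Qdelta A)].

Definition kl_fst A B : kl (A * B)%type A :=
  [the {linear Q (A * B)%type -> A} of fst \o Qeps (A * B)%type].
Definition kl_snd A B : kl (A * B)%type B :=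
  [the {linear Q (A * B)%type -> B} of snd \o Qeps (A * B)%type].

Lemma kl_pair_linear A B C (f : kl A B) (g : kl A C) :
  is_linear (fun u => (f u, g u) : (B * C)%type).
Proof. by split=> [a u|u v]; rewrite ?linearZ_LR ?linearD. Qed.

Definition kl_pair A B C (f : kl A B) (g : kl A C) : kl A (B * C)%type :=
  mklin (kl_pair_linear f g).

Definition kl_D A B (f : kl A B) : kl (A * A)%type B :=
  [the {linear Q (A * A)%type -> B} of
    f \o (Qder A \o
      (tensor_map [the {linear Q A -> Q A} of idfun] (Qeps A) \o
        (tensor_map (Qmap [the {linear (A * A)%type -> A} of fst])
                    (Qmap [the {linear (A * A)%type -> A} of snd]) \o
          QDelta (A * A)%type)))].

End CoKleisli.

Definition Kl_cdc (k : comPzSemiRingType) : cdc_data k := {|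
  ob := lSemiModType k;
  hom := fun A B => kl A B;
  idm := @kl_id k;
  comp := @kl_comp k;
  one := zero_module k;
  prd := @prod_module k;
  pr0 := @kl_fst k;
  pr1 := @kl_snd k;
  pairm := @kl_pair k;
  diff := @kl_D k
|}.

(* Main.v *)
Require Import Defs.
From mathcomp Require Import all_boot all_algebra.
From mathcomp Require Import boolp.

(** The module Q A is spanned by the brackets <x0, x1, .., xn>, and a linear
map out of Q A is the same thing as a family of functions of (x0; x1, .., xn)
that are symmetric and multilinear in x1, .., xn, because Sym A is the free
commutative algebra on A. So f |-> (f <x0, .., xn>)_n is a linear bijection
from the maps A -> B of Kl(Q) to those of the Faa di Bruno category
([Qlift_kl_faa], [kl_faa_Qlift]). Evaluating the comultiplication, the counit
and the differential of Q on brackets gives the formulas that define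
composition, identities, projections and the differential for such families
([kl_faa_comp], [kl_faa_id], [kl_faa_linear_eps], [kl_faa_D]). Hence the two
structures are isomorphic, and the axioms of a cartesian differential category
need to be verified on one side only. They are verified for families.

That verification rests on two kinds of sums over a finite list of arguments.
A [split_sum] runs over the ways to split the list into two complementary
sublists; it is coassociative and cocommutative. A [comp_sum] runs over the set
partitions of the list, as in the formula of Faa di Bruno. Singling out the
block that contains the first argument expresses a sum over partitions as a
split sum of sums over partitions of fewer arguments ([comp_sum_cons]), and
this recursion replaces every manipulation of set partitions:

- by induction on the number of arguments, precomposition with a family sends
  split sums to split sums: a partition of a list whose blocks are split into
  two groups is a splitting of the list together with a partition of each part
  ([comp_sum_prod]);
- associativity of composition follows from this by a second induction
  ([comp_sumA]);
- the differential of f at (x, y) is the split sum of the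
  f (x; eps_y (y_J), x_I) over the splittings I | J, where eps_y is the counit
  family, which sends the empty list to y, a singleton to its entry and longer
  lists to 0 ([faa_D_split]). Precomposing with a pair of families (x, v)
  gives the split sum of the f (x; v_I, -) o x ([faa_D_along]).

In this last form the remaining axioms are immediate. Linearity in v is
visible. The chain rule compares two iterated split sums over three parts that
differ by a permutation of the parts ([faa_D_comp]). The second differential
at (x, r) in the direction (s, 0) is a split sum of the f (x; r_I, s_J, -) o x,
which is symmetric in r and s ([faa_DD_base]). *)

Set Implicit Arguments.
Unset Strict Implicit.
Unset Printing Implicit Defensive.
Import GRing.Theory.
Local Open Scope ring_scope.

(** * Sums over the splittings of a list *)

(** A splitting is counted once for every set of positions, so that repeated
entries are treated as distinct. *)
Fixpoint split_sum (A : Type) (B : nmodType) (s : seq A)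
    (H : seq A -> seq A -> B) : B :=
  if s is a :: s' then
    split_sum s' (fun i j => H (a :: i) j) +
    split_sum s' (fun i j => H i (a :: j))
  else H [::] [::].

Section SplitSum.
Variables (A : Type) (B : nmodType).
Implicit Types (H K : seq A -> seq A -> B) (s : seq A).

(** The hypothesis on sizes is what inductions on the length of the list
use. *)
Lemma eq_split_sum s H K :
  (forall i j, (size i + size j = size s)%N -> H i j = K i j) ->
  split_sum s H = split_sum s K.
Proof.
elim: s H K => [|a s IHs] H K HK /=; first exact: HK.
by congr (_ + _); apply: IHs => i j ij; apply: HK; rewrite /= -ij ?addnS.
Qed.

Lemma split_sumD s H K :
  split_sum s (fun i j => H i j + K i j) = split_sum s H + split_sum s K.
Proof.
by elim: s H K => [//|a s IHs] H K /=; rewrite !IHs addrACA.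
Qed.

Lemma split_sum0 s : split_sum s (fun _ _ => 0 : B) = 0.
Proof. by elim: s => [//|a s /= ->]; rewrite addr0. Qed.

Lemma split_sumC s H : split_sum s H = split_sum s (fun i j => H j i).
Proof.
by elim: s H => [//|a s IHs] H /=; rewrite addrC; congr (_ + _); exact: IHs.
Qed.

Lemma split_sumA s (H : seq A -> seq A -> seq A -> B) :
  split_sum s (fun i j => split_sum j (H i)) =
  split_sum s (fun i j => split_sum i (fun i1 i2 => H i1 i2 j)).
Proof.
elim: s H => [//|a s IHs] H /=.
by rewrite split_sumD !IHs split_sumD addrA.
Qed.

Lemma split_sumCA s (H : seq A -> seq A -> seq A -> B) :
  split_sum s (fun i j => split_sum j (H i)) =
  split_sum s (fun i j => split_sum j (fun j1 j2 => H j1 i j2)).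
Proof.
by rewrite !split_sumA; apply: eq_split_sum => i j _; exact: split_sumC.
Qed.

Lemma split_sumAC s (H : seq A -> seq A -> seq A -> B) :
  split_sum s (fun i j => split_sum i (fun i1 i2 => H i1 i2 j)) =
  split_sum s (fun i j => split_sum i (fun i1 i2 => H i1 j i2)).
Proof.
by rewrite -!split_sumA; apply: eq_split_sum => i j _; exact: split_sumC.
Qed.

Lemma split_sum_nilr s H :
  (forall i a j, H i (a :: j) = 0) -> split_sum s H = H s [::].
Proof.
elim: s H => [//|a s IHs] H H0 /=; rewrite IHs //.
by rewrite (@eq_split_sum _ _ (fun _ _ => 0)) ?split_sum0 ?addr0.
Qed.

Lemma split_sum_nill s H :
  (forall a i j, H (a :: i) j = 0) -> split_sum s H = H [::] s.
Proof. by move=> H0; rewrite split_sumC split_sum_nilr. Qed.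

End SplitSum.

Lemma split_sum_map (A A' : Type) (B : nmodType) (f : A -> A') s
    (H : seq A' -> seq A' -> B) :
  split_sum (map f s) H = split_sum s (fun i j => H (map f i) (map f j)).
Proof. by elim: s H => [//|a s IHs] H /=; rewrite !IHs. Qed.

Lemma split_sum_linear (k : comPzSemiRingType) (A : Type)
    (B C : lSemiModType k) (L : B -> C) s (H : seq A -> seq A -> B) :
  is_linear L -> L (split_sum s H) = split_sum s (fun i j => L (H i j)).
Proof. by move=> LL; elim: s H => [//|a s IHs] H /=; rewrite LL.2 !IHs. Qed.

(** * Sums over subsets and over set partitions as list recursions *)

(** The equality is exact, not up to permutation of the arguments of K, because
filtering keeps the entries in the order of r. *)
Lemma sum_subsets_split (A : Type) (B : nmodType) (T : finType) (x : T -> A)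
    (K : seq A -> seq A -> B) (r : seq T) :
  uniq r ->
  \sum_(Y : {set T} | Y \subset [set i in r])
     K [seq x i | i <- r & i \in Y] [seq x i | i <- r & i \notin Y] =
  split_sum (map x r) K.
Proof.
elim: r K => [|i r IHr] K /=.
  move=> _; rewrite (big_pred1 set0) //= => Y.
  by rewrite set_nil subset0.
case/andP=> ir ur; rewrite (bigID (fun Y : {set T} => i \in Y)) /=.
congr (_ + _).
  rewrite -IHr // (reindex_onto (fun Y => i |: Y) (fun Y => Y :\ i)) /=.
    apply: eq_big => [Y|Y _].
      apply/idP/idP => [/andP[/andP[/subsetP Yr _] /eqP Yi]|/subsetP Yr].
        apply/subsetP => j jY; have := Yr j; rewrite !inE jY orbT => /(_ isT).
        by case/orP => // /eqP ji; rewrite -Yi !inE ji eqxx in jY.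
      rewrite setU11 andbT setU1K ?eqxx ?andbT; last first.
        by apply/negP => /Yr; rewrite inE (negPf ir).
      apply/subsetP => j; rewrite !inE => /predU1P[->|/Yr]; rewrite ?eqxx //.
      by rewrite inE => ->; rewrite orbT.
    rewrite setU11 /=; congr K; [congr (_ :: map x _)|congr map];
      apply: eq_in_filter => j jr; rewrite !inE; case: eqP => // ji;
      by rewrite -ji jr in ir.
  by move=> Y /andP[_ iY]; rewrite setD1K.
rewrite -IHr //; apply: eq_big => [Y|Y /andP[_ /negPf -> //]].
apply/idP/idP => [/andP[/subsetP Yr iY]|/subsetP Yr].
  apply/subsetP => j jY; have := Yr _ jY; rewrite !inE.
  by case/orP => // /eqP ji; rewrite ji (negPf iY) in jY.
apply/andP; split; last by apply/negP => /Yr; rewrite inE (negPf ir).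
by apply/subsetP => j /Yr; rewrite !inE => ->; rewrite orbT.
Qed.

Lemma enum_filter (T : finType) (X : {set T}) :
  enum X = [seq i <- enum T | i \in X].
Proof. by rewrite {1}/enum_mem enumT. Qed.

Lemma subset_sum_split (k : comPzSemiRingType) (A B : lSemiModType k)
    (H : seq A -> seq A -> B) s :
  subset_sum H (tnth (in_tuple s)) = split_sum s H.
Proof.
rewrite -[X in split_sum X H]/(tval (in_tuple s)) -map_tnth_enum.
rewrite -sum_subsets_split ?enum_uniq //.
apply: eq_big => [Y|Y _].
  by symmetry; apply/subsetP => i; rewrite !inE mem_enum.
rewrite /args !enum_filter; congr H; congr map; apply: eq_filter => i.
by rewrite inE.
Qed.

Section PartitionRecursion.
Variables (k : comPzSemiRingType) (A B C : lSemiModType k).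
Implicit Types (G : seq B -> C) (F : seq A -> B).

(** Partitions of a subset D are needed because removing a block from a
partition of T leaves a partition of the complement of that block. *)
Definition part_sum_in (T : finType) (x : T -> A) G F (D : {set T}) : C :=
  \sum_(P : {set {set T}} | partition P D)
    G [seq F (args x X) | X : {set T} <- enum P].

Lemma part_sum_in_block (T : finType) (x : T -> A) G F (D : {set T}) i :
  sym_multi G -> i \in D ->
  part_sum_in x G F D = \sum_(X : {set T} | (X \subset D) && (i \in X))
    part_sum_in x (fun t => G (F (args x X) :: t)) F (D :\: X).
Proof.
move=> GM iD; rewrite /part_sum_in.
rewrite (partition_big (fun P => pblock P i)
  (fun X : {set T} => (X \subset D) && (i \in X))) /=; last first.
  move=> P pP; have iP : i \in cover P by rewrite (cover_partition pP).
  by rewrite (partitionS pP) ?pblock_mem //= mem_pblock.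
apply: eq_bigr => X /andP[XD iX].
rewrite (reindex_onto (fun P => X |: P) (fun P => P :\ X)) /=; last first.
  move=> P /andP[pP /eqP <-]; rewrite setD1K // pblock_mem //.
  by rewrite (cover_partition pP).
have XP P : partition P (D :\: X) -> X \notin P.
  move=> pP; apply/negP => /(partitionS pP)/subsetP/(_ i iX).
  by rewrite inE iX.
apply: eq_big => [P|P /andP[/andP[pP _] /eqP XPK]].
  apply/idP/idP => [/andP[/andP[pP _] /eqP <-]|pP].
    by apply: (partitionD1 pP); rewrite setU11.
  have XN0 : X != set0 by apply/set0Pn; exists i.
  have pXP : partition (X |: P) D.
    have -> : D = X :|: (D :\: X).
      apply/setP => j; rewrite !inE; have := subsetP XD j.
      by case: (j \in X) => // /(_ isT) ->.
    apply: partitionU1; rewrite // disjoints_subset.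
    by apply/subsetP => j; rewrite !inE => ->.
  rewrite pXP setU1K ?XP // eqxx andbT /=.
  by rewrite (def_pblock (partition_trivIset pXP) (setU11 _ _) iX).
apply: GM.1.
rewrite -[_ :: _]/([seq F (args x Y) | Y : {set T} <- X :: enum P]).
apply: perm_map; have := enum_setD1_perm (setU11 X P).
by rewrite XPK.
Qed.

Lemma part_sum_in_inj (T T' : finType) (h : T' -> T) (x : T -> A) G F :
  sym_multi G -> sym_multi F -> injective h ->
  part_sum_in x G F (h @: [set: T']) = part_sum G F (x \o h).
Proof.
move=> GM FM hI; rewrite /part_sum_in /part_sum.
pose H (P : {set {set T'}}) := [set h @: (X : {set T'}) | X in P].
pose H' (P : {set {set T}}) := [set h @^-1: (X : {set T}) | X in P].
have hK (X : {set T'}) : h @^-1: (h @: X) = X.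
  by apply/setP => j; rewrite inE mem_imset.
rewrite (reindex_onto H H') /=; last first.
  move=> P pP; rewrite /H /H' -imset_comp -[RHS]imset_id.
  apply: eq_in_imset => X XP /=.
  apply/setP => j; apply/imsetP/idP => [[j' + ->]|jX]; first by rewrite inE.
  have /imsetP[j' _ jE] := subsetP (partitionS pP XP) _ jX.
  by exists j' => //; rewrite inE -jE.
have HK P : H' (H P) = P.
  by rewrite /H /H' -imset_comp -[RHS]imset_id; apply: eq_imset => X /=.
apply: eq_big => [P|P _]; first by rewrite HK eqxx andbT imset_partition.
have hhI : injective (fun X : {set T'} => h @: X) by apply: imset_inj.
apply: GM.1; apply: perm_trans (args_imset (fun X => F (args x X)) P hhI) _.
rewrite /args; have -> // : forall s t : seq B, s = t -> perm_eq s t.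
  by move=> s _ <-.
by apply: eq_map => X /=; apply: FM.1; exact: args_imset.
Qed.

(** This is the sum of the composition formula: the composite of two families
g and f at (x; s) is [comp_sum G F s] for G = g (f x; -) and F = f (x; -). *)
Definition comp_sum G F (s : seq A) : C := part_sum G F (tnth (in_tuple s)).

Lemma part_sum_in_seq (T : finType) (x : T -> A) G F (D : {set T}) :
  sym_multi G -> sym_multi F -> part_sum_in x G F D = comp_sum G F (args x D).
Proof.
move=> GM FM.
pose h (j : 'I_(size (args x D))) : T :=
  tnth (in_tuple (enum D)) (cast_ord (size_map _ _) j).
have hI : injective h.
  move=> i j /(elimT (tuple_uniqP (in_tuple (enum D))) (enum_uniq _)).
  exact: cast_ord_inj.
have hD : D = h @: [set: 'I_(size (args x D))].
  apply/setP => i; apply/idP/imsetP => [iD|[j _ ->]].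
    have iE : i \in enum D by rewrite mem_enum.
    have iS : (index i (enum D) < size (args x D))%N.
      by rewrite size_map index_mem.
    by exists (Ordinal iS); rewrite // /h (tnth_nth i) /= nth_index.
  have := mem_tnth (cast_ord (size_map x (enum D)) j) (in_tuple (enum D)).
  by rewrite mem_enum.
transitivity (part_sum_in x G F (h @: setT)); first by rewrite -hD.
rewrite (part_sum_in_inj x GM FM hI) /comp_sum; congr part_sum.
apply/funext => j; have jD : (j < size (enum D))%N.
  by move: (ltn_ord j); rewrite [X in (_ < X)%N]size_map.
rewrite /= (tnth_nth (x (h j))) /= (nth_map (h j)) //; congr x.
by rewrite {1}/h (tnth_nth (h j)).
Qed.

Lemma comp_sum_nil G F : comp_sum G F [::] = G [::].
Proof.
rewrite /comp_sum /part_sum (big_pred1 set0) => [|P].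
  by rewrite enum_set0.
have -> : [set: 'I_(size (Nil A))] = set0 by apply/setP => -[].
by rewrite partition_set0.
Qed.

(** The block that contains the first argument a is [a :: i], where i is an
arbitrary sublist of s, and the other blocks partition the complement j. *)
Lemma comp_sum_cons G F a s : sym_multi G -> sym_multi F ->
  comp_sum G F (a :: s) =
  split_sum s (fun i j => comp_sum (fun t => G (F (a :: i) :: t)) F j).
Proof.
move=> GM FM; pose x := tnth (in_tuple (a :: s)).
have GM' b : sym_multi (fun t => G (b :: t)) := sym_multi_cat [:: b] GM.
have x0 : x ord0 = a by rewrite /x (tnth_nth 0).
pose r : seq 'I_(size s).+1 := map (lift ord0) (enum 'I_(size s)).
have enumE : enum 'I_(size s).+1 = ord0 :: r by rewrite enum_ordSl.
have := enum_uniq 'I_(size s).+1; rewrite enumE => /andP[r0 ur].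
have mem_r i : (i \in r) = (i != ord0).
  have := mem_enum 'I_(size s).+1 i; rewrite enumE !inE.
  by case: eqP => [-> _|//]; rewrite (negPf r0).
have xr : map x r = s.
  have := map_tnth_enum (in_tuple (a :: s)).
  by rewrite -[size (a :: s)]/((size s).+1) enumE => -[].
transitivity (part_sum_in x G F setT) => //.
rewrite (part_sum_in_block x F GM (in_setT ord0)) -[X in split_sum X]xr.
rewrite -(sum_subsets_split _ _ ur).
rewrite (reindex_onto (fun Y => ord0 |: Y) (fun Y => Y :\ ord0)) /=; last first.
  by move=> Y /andP[_ iY]; rewrite setD1K.
apply: eq_big => [Y|Y /andP[_ /eqP Y0]].
  rewrite subsetT setU11 /=; apply/eqP/subsetP => [Y0 i|rY].
    by rewrite -Y0 !inE mem_r => /andP[].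
  by rewrite setU1K //; apply/negP => /rY; rewrite inE (negPf r0).
rewrite part_sum_in_seq // setTD.
have -> : args x (ord0 |: Y) = a :: [seq x i | i <- r & i \in Y].
  rewrite /args enum_filter enumE /= setU11 /= x0; congr (_ :: map x _).
  by apply: eq_in_filter => i; rewrite mem_r !inE => /negPf ->.
congr comp_sum; rewrite /args enum_filter enumE /= inE setU11 /=.
by congr (map x _); apply: eq_in_filter => i; rewrite mem_r !inE => /negPf ->.
Qed.

End PartitionRecursion.

(** * Composition of symmetric multilinear families *)

Section SymMulti.
Variable k : comPzSemiRingType.
Implicit Types A B C : lSemiModType k.

Definition sym_multi2 A B C (H : seq A -> seq B -> C) : Prop :=
  (forall s, sym_multi (H s)) /\ (forall t, sym_multi (H^~ t)).

Lemma split_sum_sym_multi A B (H : seq A -> seq A -> B) :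
  sym_multi2 H -> sym_multi (fun s => split_sum s H).
Proof.
move=> [H2 H1]; have := subset_sum_sym_multi H1 H2; congr sym_multi.
by apply/funext => s; rewrite subset_sum_split.
Qed.

Lemma sym_multi_cons A B (G : seq A -> B) a :
  sym_multi G -> sym_multi (fun t => G (a :: t)).
Proof. exact: sym_multi_cat [:: a]. Qed.

Lemma sym_multi_swap A B (G : seq A -> B) a b t :
  sym_multi G -> G [:: a, b & t] = G [:: b, a & t].
Proof.
by move=> [GP _]; apply: GP; exact/permPl/(perm_catCA [:: a] [:: b]).
Qed.

Lemma sym_multi_comp A B C (L : B -> C) (G : seq A -> B) :
  is_linear L -> sym_multi G -> sym_multi (fun t => L (G t)).
Proof.
move=> LL [GP GL]; split=> [s t /GP -> //|s].
exact: is_linear_comp LL (GL s).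
Qed.

Lemma sym_multi_map A B C (L : A -> B) (G : seq B -> C) :
  is_linear L -> sym_multi G -> sym_multi (fun t => G (map L t)).
Proof.
move=> LL [GP GL]; split=> [s t st|s]; first exact/GP/perm_map.
exact: is_linear_comp (GL _) LL.
Qed.

Lemma is_linear_scaler A a : is_linear (fun u : A => a *: u).
Proof. exact/is_linear_scale/is_linear_id. Qed.

Lemma is_linear_pair A B C (f : A -> B) (g : A -> C) :
  is_linear f -> is_linear g -> is_linear (fun u => (f u, g u) : (B * C)%type).
Proof.
move=> [fZ fD] [gZ gD]; split=> [a u|u v]; first by rewrite fZ gZ.
by rewrite fD gD.
Qed.

End SymMulti.

Section CompSum.
Variable k : comPzSemiRingType.
Implicit Types A B C D : lSemiModType k.

Lemma comp_sum_linear A B C D (L : C -> D) (G : seq B -> C) (F : seq A -> B) s :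
  is_linear L -> comp_sum (fun t => L (G t)) F s = L (comp_sum G F s).
Proof. by move=> LL; rewrite /comp_sum /part_sum is_linear_sum. Qed.

Lemma comp_sumD A B C (G G' : seq B -> C) (F : seq A -> B) s :
  comp_sum (fun t => G t + G' t) F s = comp_sum G F s + comp_sum G' F s.
Proof. exact: big_split. Qed.

Lemma comp_sum0 A B C (F : seq A -> B) s : comp_sum (fun _ => 0 : C) F s = 0.
Proof. exact: big1. Qed.

Lemma comp_sum_split A B C (I : Type) (u : seq I)
    (K : seq B -> seq I -> seq I -> C) (F : seq A -> B) s :
  comp_sum (fun t => split_sum u (K t)) F s =
  split_sum u (fun i j => comp_sum (fun t => K t i j) F s).
Proof. by elim: u K => [//|a u IHu] K /=; rewrite comp_sumD !IHu. Qed.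

Lemma is_linear_comp_sum A B C D (G : D -> seq B -> C) (F : seq A -> B) s :
  (forall t, is_linear (G^~ t)) -> is_linear (fun u => comp_sum (G u) F s).
Proof. by move=> GL; apply: is_linear_bigsum. Qed.

Lemma comp_sum_sym_multi A B C (G : seq B -> C) (F : seq A -> B) :
  sym_multi G -> sym_multi F -> sym_multi (comp_sum G F).
Proof. exact: part_sum_sym_multi. Qed.

Lemma comp_sum_sym_multi_l A B C D (H : seq D -> seq B -> C)
    (F : seq A -> B) s :
  (forall t, sym_multi (H^~ t)) -> sym_multi (fun t => comp_sum (H t) F s).
Proof.
move=> HM; split=> [t u tu|t].
  by congr comp_sum; apply/funext => v; apply: (HM v).1.
by apply: is_linear_comp_sum => v; exact: (HM v).2.
Qed.

(** To split the list of the blocks of a partition of s is to split s into i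
and j and to partition i and j separately. *)
Lemma comp_sum_prod A B C (H : seq B -> seq B -> C) (F : seq A -> B) s :
  sym_multi2 H -> sym_multi F ->
  comp_sum (fun t => split_sum t H) F s =
  split_sum s (fun i j => comp_sum (fun t => comp_sum (H t) F j) F i).
Proof.
move=> HM FM; have [n sn] := ubnP (size s).
elim: n => // n IHn in s sn H HM *.
case: s sn => [|a s] sn; first by rewrite /= !comp_sum_nil.
have [H2 H1] := HM.
rewrite comp_sum_cons //=; last exact: split_sum_sym_multi.
(* P and R collect the partitions whose first block goes to the first,
   respectively to the second, group. *)
pose P i j1 j2 :=
  comp_sum (fun t => comp_sum (H (F (a :: i) :: t)) F j2) F j1.
pose R i j1 j2 :=
  comp_sum (fun t => comp_sum (fun t' => H t (F (a :: i) :: t')) F j2) F j1.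
transitivity (split_sum s (fun i j => split_sum j (P i) + split_sum j (R i))).
  apply: eq_split_sum => i j ij; have jn : (size j < n)%N.
    by apply: leq_ltn_trans (_ : size s < n)%N => //; rewrite -ij leq_addl.
  rewrite comp_sumD !IHn //; split=> t; first [exact: H1 | exact: H2 |
    exact: sym_multi_cons | exact: (sym_multi_cons (G := H^~ t))].
rewrite split_sumD; congr (_ + _).
  rewrite split_sumA; apply: eq_split_sum => i j _.
  by rewrite comp_sum_cons //; exact: comp_sum_sym_multi_l.
rewrite split_sumCA; apply: eq_split_sum => i j _.
rewrite -comp_sum_split; congr comp_sum; apply/funext => t.
by rewrite comp_sum_cons.
Qed.

(** Both sides are expanded at the block of the first argument a. On the left
that block is a :: i for the outer partition, and it is then partitioned in
turn; on the right its part that contains a is chosen first, and the rest of it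
comes from the product formula. *)
Lemma comp_sumA A B C D (H : seq C -> D) (G : seq B -> C) (F : seq A -> B) s :
  sym_multi H -> sym_multi G -> sym_multi F ->
  comp_sum H (comp_sum G F) s = comp_sum (comp_sum H G) F s.
Proof.
move=> HM GM FM; have GFM := comp_sum_sym_multi GM FM.
have [n sn] := ubnP (size s).
elim: n => // n IHn in s sn H HM *.
case: s sn => [|a s] sn; first by rewrite !comp_sum_nil.
have HcM u : sym_multi (fun t => H (u :: t)) := sym_multi_cons u HM.
rewrite comp_sum_cons //.
pose L j u := comp_sum (comp_sum (fun t => H (u :: t)) G) F j.
have LL j : is_linear (L j).
  by do 2! [apply: is_linear_comp_sum => ?]; exact: HM.2.
pose P i j1 j2 := L j2 (comp_sum (fun t => G (F (a :: i) :: t)) F j1).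
transitivity (split_sum s (fun i j => split_sum i (fun i1 i2 => P i1 i2 j))).
  apply: eq_split_sum => i j ij; have jn : (size j < n)%N.
    by apply: leq_ltn_trans (_ : size s < n)%N => //; rewrite -ij leq_addl.
  by rewrite IHn // -/(L j _) comp_sum_cons // (split_sum_linear _ _ (LL j)).
rewrite comp_sum_cons //; last exact: comp_sum_sym_multi.
rewrite -split_sumA; apply: eq_split_sum => i j _.
have -> : (fun t => comp_sum H G (F (a :: i) :: t)) = (fun t => split_sum t
    (fun t1 t2 => comp_sum (fun v => H (G (F (a :: i) :: t1) :: v)) G t2)).
  by apply/funext => t; rewrite comp_sum_cons.
rewrite comp_sum_prod //; last first.
  split=> t; first exact: comp_sum_sym_multi.
  apply: (sym_multi_comp (L := fun u => comp_sum (fun v => H (u :: v)) G t)).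
    by apply: is_linear_comp_sum => v; exact: HM.2.
  exact: sym_multi_cons.
by apply: eq_split_sum => j1 j2 _; rewrite /P -(comp_sum_linear _ _ _ (LL j2)).
Qed.

Lemma comp_sum_linear_l A B C (L : B -> C) (F : seq A -> B) s :
  is_linear L -> sym_multi F ->
  comp_sum (linear_faa_at L (F [::])) F s = L (F s).
Proof.
move=> LL FM; case: s => [|a s]; first by rewrite comp_sum_nil.
have LM := linear_faa_sym_multi (F [::]) LL.
rewrite comp_sum_cons // split_sum_nilr ?comp_sum_nil // => i b j.
rewrite comp_sum_cons //; last exact: sym_multi_cons.
rewrite -[RHS](split_sum0 _ j); apply: eq_split_sum => j1 j2 _.
by rewrite /= comp_sum0.
Qed.

Lemma comp_sum_linear_r A B C (G : seq B -> C) (L : A -> B) x s :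
  is_linear L -> sym_multi G ->
  comp_sum G (linear_faa_at L x) s = G (map L s).
Proof.
move=> LL; elim: s G => [|a s IHs] G GM; first by rewrite comp_sum_nil.
have LM := linear_faa_sym_multi x LL.
rewrite comp_sum_cons // split_sum_nill => [|b i j] /=.
  by rewrite IHs //; exact: sym_multi_cons.
rewrite -[RHS](comp_sum0 _ (linear_faa_at L x) j); congr comp_sum.
by apply/funext => t; rewrite (is_linear0 (GM.2 t)).
Qed.

Lemma comp_sum_map_l A B C D (G : seq C -> D) (L : B -> C) (F : seq A -> B) s :
  comp_sum (fun t => G (map L t)) F s = comp_sum G (fun b => L (F b)) s.
Proof. by apply: eq_bigr => P _; rewrite -map_comp. Qed.

Lemma comp_sum_map_r A B C D (G : seq C -> D) (F : seq B -> C) (L : A -> B) s :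
  is_linear L -> sym_multi G -> sym_multi F ->
  comp_sum G (fun b => F (map L b)) s = comp_sum G F (map L s).
Proof.
move=> LL GM FM; have LM := linear_faa_sym_multi 0 LL.
rewrite -(comp_sum_linear_r 0 s LL (comp_sum_sym_multi GM FM)) -comp_sumA //.
by congr comp_sum; apply/funext => b; rewrite comp_sum_linear_r.
Qed.

End CompSum.

(** * The axioms for the Faa di Bruno category *)

Section FaaAxioms.
Variable k : comPzSemiRingType.
Implicit Types A B C D X : lSemiModType k.

Lemma faa_comp_at A B C (g : faa B C) (f : faa A B) x s :
  faa_at (faa_comp g f) x s =
  comp_sum (faa_at g (faa_at f x [::])) (faa_at f x) s.
Proof. by []. Qed.

Lemma faa_add_at A B (f g : faa A B) x s :
  faa_at (f + g) x s = faa_at f x s + faa_at g x s.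
Proof. by []. Qed.

Lemma faa_scale_at A B a (f : faa A B) x s :
  faa_at (a *: f) x s = a *: faa_at f x s.
Proof. by []. Qed.

Lemma faa_comp_linear_l A B C (L : {linear B -> C}) (f : faa A B) x s :
  faa_at (faa_comp (linear_faa L) f) x s = L (faa_at f x s).
Proof.
apply: comp_sum_linear_l; [exact: linear_is_linear | exact: faa_at_sym_multi].
Qed.

Lemma faa_comp_linear_r A B C (g : faa B C) (L : {linear A -> B}) x s :
  faa_at (faa_comp g (linear_faa L)) x s = faa_at g (L x) (map L s).
Proof.
apply: comp_sum_linear_r; [exact: linear_is_linear | exact: faa_at_sym_multi].
Qed.

Lemma faa_compA A B C D (h : faa C D) (g : faa B C) (f : faa A B) :
  faa_comp h (faa_comp g f) = faa_comp (faa_comp h g) f.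
Proof.
apply: faa_ext => x s; rewrite !faa_comp_at comp_sumA ?comp_sum_nil //;
  exact: faa_at_sym_multi.
Qed.

Lemma faa_comp_is_linear A B C (f : faa A B) :
  is_linear (fun g : faa B C => faa_comp g f).
Proof.
split=> [a g|g h]; apply: faa_ext => x s; last exact: comp_sumD.
by apply: (comp_sum_linear (L := fun u => a *: u)); exact: is_linear_scaler.
Qed.

Lemma faa_comp_linear_is_linear A B C (L : {linear B -> C}) :
  is_linear (fun f : faa A B => faa_comp (linear_faa L) f).
Proof.
split=> [a f|f g]; apply: faa_ext => x s.
  by rewrite faa_scale_at !faa_comp_linear_l faa_scale_at linearZ_LR.
by rewrite faa_add_at !faa_comp_linear_l faa_add_at linearD.
Qed.

Lemma faa_pair_comp A B X (h : faa X (A * B)%type) :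
  faa_pair (faa_comp (faa_fst A B) h) (faa_comp (faa_snd A B) h) = h.
Proof.
apply: faa_ext => x s; rewrite mkfaaE !faa_comp_linear_l /=.
by case: (faa_at h x s).
Qed.

(** The factor [linear_faa_at snd x j] vanishes when j has two or more entries.
The splitting with j empty gives the term of the differential with the
additional argument y0, and the splitting with j = [:: (x_i, y_i)] gives the
term in which y_i replaces x_i. *)
Lemma faa_D_split A B (f : faa A B) (x : A * A) s :
  faa_at (faa_D f) x s = split_sum s
    (fun i j => faa_at f x.1 (linear_faa_at snd x j :: map fst i)).
Proof.
rewrite mkfaaE /faa_D_at.
move: (faa_at f x.1) (faa_at_sym_multi f x.1) => phi phiM {f}.
elim: s phi phiM => [|z s IHs] phi phiM.
  by rewrite /subst_sum big_ord0 addr0.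
rewrite subst_sum_cons addrCA /= addrC; congr (_ + _).
  rewrite IHs; last exact: sym_multi_cons.
  by apply: eq_split_sum => i j _; exact: sym_multi_swap.
rewrite split_sum_nilr // => i a j /=; exact: (is_linear0 (phiM.2 _)).
Qed.

Lemma faa_D_is_linear A B : is_linear (@faa_D k A B).
Proof.
split=> [a f|f g]; apply: faa_ext => x s; last first.
  by rewrite faa_add_at !faa_D_split split_sumD.
rewrite faa_scale_at !faa_D_split.
by rewrite (split_sum_linear _ _ (is_linear_scaler _ a)).
Qed.

Lemma faa_D_linear A B (L : {linear A -> B}) :
  faa_D (linear_faa L) = faa_comp (linear_faa L) (faa_snd A A).
Proof.
apply: faa_ext => z s; rewrite faa_D_split faa_comp_linear_l.
by rewrite split_sum_nill.
Qed.

(** By the product formula, precomposing the split sum of [faa_D_split] with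
(x, v) turns the factor [linear_faa_at snd] into v on one part of s, and leaves
a composite with x on the other. *)
Lemma faa_D_along A B X (f : faa A B) (x v : faa X A) z s :
  faa_at (faa_comp (faa_D f) (faa_pair x v)) z s =
  split_sum s (fun i j => comp_sum
    (fun t => faa_at f (faa_at x z [::]) (faa_at v z i :: t)) (faa_at x z) j).
Proof.
rewrite faa_comp_at; set phi := faa_at f (faa_at x z [::]).
have phiM : sym_multi phi := faa_at_sym_multi _ _.
have pM := faa_at_sym_multi (faa_pair x v) z.
have fstL := linear_is_linear [the {linear (A * A)%type -> A} of fst].
have sndL := linear_is_linear [the {linear (A * A)%type -> A} of snd].
pose eps := linear_faa_at snd (faa_at (faa_pair x v) z [::]).
have epsM : sym_multi eps := linear_faa_sym_multi _ sndL.
have -> : faa_at (faa_D f) (faa_at (faa_pair x v) z [::]) =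
    (fun t => split_sum t (fun i j => phi (eps j :: map fst i))).
  by apply/funext => t; rewrite faa_D_split.
rewrite comp_sum_prod //; last first.
  split=> t.
    exact: (sym_multi_comp (L := fun u => phi (u :: map fst t)) (phiM.2 _)).
  exact: (sym_multi_map (G := fun t' => phi (eps t :: t')) fstL
    (sym_multi_cons _ phiM)).
rewrite split_sumC; apply: eq_split_sum => i j _.
rewrite -[RHS](comp_sum_map_l _ fst (faa_at (faa_pair x v) z)); congr comp_sum.
apply/funext => t; rewrite (comp_sum_linear _ _ _ (phiM.2 (map fst t))).
by rewrite comp_sum_linear_l.
Qed.

Lemma faa_D_linear2 A B X (f : faa A B) (x : faa X A) :
  is_linear (fun v : faa X A => faa_comp (faa_D f) (faa_pair x v)).
Proof.
have phiL z t := (faa_at_sym_multi f (faa_at x z [::])).2 t.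
split=> [a v|v w]; apply: faa_ext => z s.
  have aL := is_linear_scaler B a.
  rewrite faa_scale_at !faa_D_along (split_sum_linear _ _ aL).
  apply: eq_split_sum => i j _; rewrite -(comp_sum_linear _ _ _ aL).
  by congr comp_sum; apply/funext => t; rewrite faa_scale_at (phiL _ _).1.
rewrite faa_add_at !faa_D_along -split_sumD.
apply: eq_split_sum => i j _; rewrite -comp_sumD; congr comp_sum.
by apply/funext => t; rewrite faa_add_at (phiL _ _).2.
Qed.

(** Expanding the composite inside the differential at its first argument, or
the differential inside the composite, gives the same summands T, indexed by
the splittings of s into three parts: the rest of the first block, the argument
of [linear_faa_at snd], and the arguments of the other blocks. *)
Lemma faa_D_comp A B C (g : faa B C) (f : faa A B) :
  faa_D (faa_comp g f) =
  faa_comp (faa_D g) (faa_pair (faa_comp f (faa_fst A A)) (faa_D f)).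
Proof.
apply: faa_ext => z s; rewrite faa_D_along faa_D_split.
set G := faa_at g (faa_at (faa_comp f (faa_fst A A)) z [::]).
have GE : G = faa_at g (faa_at f z.1 [::]) by rewrite /G faa_comp_linear_r.
have GM : sym_multi G := faa_at_sym_multi _ _.
have FM := faa_at_sym_multi f z.1.
have fstL := linear_is_linear [the {linear (A * A)%type -> A} of fst].
pose L (j : seq (A * A)) u :=
  comp_sum (fun t => G (u :: t)) (faa_at f z.1) (map fst j).
have LL j : is_linear (L j) by apply: is_linear_comp_sum => t; exact: GM.2.
pose T (i1 i2 j : seq (A * A)) :=
  L i2 (faa_at f z.1 (linear_faa_at snd z j :: map fst i1)).
transitivity (split_sum s (fun i j => split_sum i (fun i1 i2 => T i1 i2 j))).
  apply: eq_split_sum => i j _; rewrite faa_comp_at -GE comp_sum_cons //.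
  by rewrite split_sum_map.
rewrite split_sumAC; apply: eq_split_sum => i j _.
have -> : faa_at (faa_comp f (faa_fst A A)) z =
    fun b => faa_at f z.1 (map fst b).
  by apply/funext => b; rewrite faa_comp_linear_r.
rewrite comp_sum_map_r //; last exact: sym_multi_cons.
by rewrite faa_D_split -/(L j _) (split_sum_linear _ _ (LL j)).
Qed.

(** A summand that evaluates f at the first component 0 vanishes. What is left
is the one in which v replaces it, where the direction x.2 does not occur. *)
Lemma faa_D_at_snd A B (f : faa A B) (x : A * A) (v : A) t :
  faa_at (faa_D f) x ((0, v) :: t) = faa_at f x.1 (v :: map fst t).
Proof.
have fM := faa_at_sym_multi f x.1.
rewrite faa_D_split /= addrC split_sum_nilr => [|i a j] /=; last first.
  exact: (is_linear0 (fM.2 _)).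
rewrite -[RHS]addr0; congr (_ + _).
rewrite -[RHS](split_sum0 _ t); apply: eq_split_sum => i j _.
by rewrite (sym_multi_swap _ _ _ fM) (is_linear0 (fM.2 _)).
Qed.

Lemma faa_D_at_fst A B (f : faa A B) (x : A * A) (r : A) t :
  faa_at (faa_D f) x ((r, 0) :: t) =
  split_sum t
    (fun i j => faa_at f x.1 [:: r, linear_faa_at snd x j & map fst i]).
Proof.
have fM := faa_at_sym_multi f x.1.
rewrite faa_D_split /= addrC.
rewrite split_sum_nilr => [|i a j] /=; last exact: (is_linear0 (fM.2 _)).
rewrite (is_linear0 (fM.2 _)) add0r; apply: eq_split_sum => i j _.
exact: sym_multi_swap.
Qed.

Lemma faa_DD_lin A B X (f : faa A B) (x r v : faa X A) :
  faa_comp (faa_D (faa_D f)) (faa_pair (faa_pair x r) (faa_pair 0 v)) =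
  faa_comp (faa_D f) (faa_pair x v).
Proof.
apply: faa_ext => z s; rewrite !faa_D_along; apply: eq_split_sum => i j _.
rewrite -[RHS](comp_sum_map_l _ fst (faa_at (faa_pair x r) z)); congr comp_sum.
apply/funext => t.
by rewrite -[RHS](faa_D_at_snd f (faa_at (faa_pair x r) z [::])).
Qed.

Lemma faa_DD_base A B X (f : faa A B) (x r v : faa X A) z s :
  faa_at (faa_comp (faa_D (faa_D f))
    (faa_pair (faa_pair x r) (faa_pair v 0))) z s =
  split_sum s (fun i j => split_sum j (fun j1 j2 => comp_sum
    (fun t => faa_at f (faa_at x z [::])
       [:: faa_at r z j1, faa_at v z i & t]) (faa_at x z) j2)).
Proof.
rewrite faa_D_along; apply: eq_split_sum => i j _.
have fM := faa_at_sym_multi f (faa_at x z [::]).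
(* With the argument v_i of f held fixed, what remains is a differential of
   the family g along (x, r). *)
pose g : faa A B :=
  mkfaa (fun y => sym_multi_cons (faa_at v z i) (faa_at_sym_multi f y)).
transitivity (faa_at (faa_comp (faa_D g) (faa_pair x r)) z j).
  rewrite faa_comp_at; congr comp_sum; apply/funext => t.
  by rewrite [RHS]faa_D_split; exact: faa_D_at_fst.
rewrite faa_D_along; apply: eq_split_sum => j1 j2 _.
congr comp_sum; apply/funext => t; rewrite mkfaaE; exact: sym_multi_swap.
Qed.

Lemma faa_DD_sym A B X (f : faa A B) (x r s : faa X A) :
  faa_comp (faa_D (faa_D f)) (faa_pair (faa_pair x r) (faa_pair s 0)) =
  faa_comp (faa_D (faa_D f)) (faa_pair (faa_pair x s) (faa_pair r 0)).
Proof.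
apply: faa_ext => z t; rewrite !faa_DD_base split_sumCA.
have fM := faa_at_sym_multi f (faa_at x z [::]).
apply: eq_split_sum => i j _; apply: eq_split_sum => j1 j2 _.
congr comp_sum; apply/funext => u; exact: sym_multi_swap.
Qed.

Lemma Faa_is_cdc : is_cdc (Faa_cdc k).
Proof.
split=> /=.
- by move=> A B f; apply: faa_ext => x s; rewrite faa_comp_linear_l.
- by move=> A B f; apply: faa_ext => x s; rewrite faa_comp_linear_r map_id.
- move=> A B C D; exact: faa_compA.
- move=> A B C; exact: faa_comp_is_linear.
- by move=> A f g; apply: faa_ext => x s; apply/rowP => -[].
- by move=> X A B f g; apply: faa_ext => x s; rewrite faa_comp_linear_l.
- by move=> X A B f g; apply: faa_ext => x s; rewrite faa_comp_linear_l.
- move=> X A B; exact: faa_pair_comp.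
- move=> X A B; apply: is_linear_pair; exact: faa_comp_linear_is_linear.
- exact: faa_D_is_linear.
- move=> X A B; exact: faa_D_linear2.
- move=> A B; exact: faa_D_linear.
- move=> A B; exact: faa_D_linear.
- move=> A; rewrite /faa_id faa_D_linear.
  by apply: faa_ext => x s; rewrite faa_comp_linear_l.
- move=> A B C; exact: faa_D_comp.
- move=> X A B; exact: faa_DD_lin.
- move=> X A B; exact: faa_DD_sym.
Qed.

End FaaAxioms.

(** * The co-Kleisli category of Q *)

Section CoKleisliFaa.
Variable k : comPzSemiRingType.
Implicit Types A B C X : lSemiModType k.

Lemma Qmap_bra A B (f : {linear A -> B}) x s :
  Qmap f (bra x s) = bra (f x) (map f s).
Proof. exact: Qlift_bra. Qed.

Lemma Qdelta_bra A (x : A) s :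
  Qdelta A (bra x s) = comp_sum (bra (bra x [::])) (bra x) s.
Proof. exact: Qlift_bra. Qed.

Lemma QDelta_bra A (x : A) s :
  QDelta A (bra x s) = split_sum s (fun i j => tens (bra x i) (bra x j)).
Proof. by rewrite [LHS]Qlift_bra mkfaaE subset_sum_split. Qed.

Lemma Qder_bra A (x : A) s y :
  Qder A (tens (bra x s) y) = bra x (rcons s y).
Proof. by rewrite [LHS]tensor_liftE Qlift_bra. Qed.

Definition kl_faa A B (f : kl A B) : faa A B := mkfaa (fun x =>
  sym_multi_comp (linear_is_linear (f : {linear Q A -> B})) (bra_sym_multi x)).

Lemma kl_faaE A B (f : kl A B) x s : faa_at (kl_faa f) x s = f (bra x s).
Proof. by []. Qed.

Lemma Qlift_kl_faa A B : cancel (@kl_faa A B) (fun f => Qlift f : kl A B).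
Proof.
move=> f; apply: lin_ext; apply: Q_ext.
- exact: Qlift_linear.
- exact: linear_is_linear.
- by move=> x s; rewrite Qlift_bra.
Qed.

Lemma kl_faa_Qlift A B : cancel (fun f => Qlift f : kl A B) (@kl_faa A B).
Proof. by move=> f; apply: faa_ext => x s; rewrite kl_faaE Qlift_bra. Qed.

Lemma kl_faa_inj A B : injective (@kl_faa A B).
Proof. exact: can_inj (@Qlift_kl_faa A B). Qed.

Lemma kl_faa_linear A B : is_linear (@kl_faa A B).
Proof. by split=> [a f|f g]; apply: faa_ext. Qed.

Lemma kl_faa0 A B : kl_faa (0 : kl A B) = 0.
Proof. exact: is_linear0 (kl_faa_linear A B). Qed.

Lemma kl_faa_id A : kl_faa (kl_id A) = faa_id A.
Proof. by apply: faa_ext => x s; rewrite kl_faaE [LHS]Qlift_bra. Qed.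

Lemma kl_faa_linear_eps A B (L : {linear A -> B}) :
  kl_faa [the {linear Q A -> B} of L \o Qeps A] = linear_faa L.
Proof.
apply: faa_ext => x s; transitivity (L (Qeps A (bra x s))) => //.
rewrite [Qeps A _]Qlift_bra !mkfaaE.
by case: s => [|a [|b s]] //=; rewrite linear0.
Qed.

Lemma kl_faa_fst A B : kl_faa (kl_fst A B) = faa_fst A B.
Proof. exact: kl_faa_linear_eps. Qed.

Lemma kl_faa_snd A B : kl_faa (kl_snd A B) = faa_snd A B.
Proof. exact: kl_faa_linear_eps. Qed.

Lemma kl_faa_pair A B X (f : kl X A) (g : kl X B) :
  kl_faa (kl_pair f g) = faa_pair (kl_faa f) (kl_faa g).
Proof. exact: faa_ext. Qed.

Lemma kl_faa_comp A B C (g : kl B C) (f : kl A B) :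
  kl_faa (kl_comp g f) = faa_comp (kl_faa g) (kl_faa f).
Proof.
apply: faa_ext => x s; rewrite faa_comp_at.
transitivity (g (Qmap f (Qdelta A (bra x s)))) => //; rewrite Qdelta_bra.
have gfL := is_linear_comp (linear_is_linear (g : {linear Q B -> C}))
  (linear_is_linear (Qmap f)).
rewrite -[LHS](comp_sum_linear _ _ _ gfL).
rewrite -[RHS](comp_sum_map_l _ f (bra x)); congr comp_sum.
by apply/funext => t; exact: (congr1 (fun u => g u) (Qmap_bra f _ t)).
Qed.

(** On a bracket, the composite that defines the differential of Kl(Q) is the
split sum of [faa_D_split], with the counit of Q in the role of
[linear_faa_at snd]. *)
Lemma kl_faa_D A B (f : kl A B) : kl_faa (kl_D f) = faa_D (kl_faa f).
Proof.
apply: faa_ext => z s; rewrite faa_D_split.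
transitivity (f (Qder A
  (tensor_map [the {linear Q A -> Q A} of idfun] (Qeps A)
    (tensor_map (Qmap [the {linear (A * A)%type -> A} of fst])
      (Qmap [the {linear (A * A)%type -> A} of snd])
      (QDelta (A * A)%type (bra z s)))))) => //.
rewrite QDelta_bra !(split_sum_linear _ _ (linear_is_linear _)).
apply: eq_split_sum => i j _.
rewrite !tensor_mapE !Qmap_bra Qder_bra [Qeps A _]Qlift_bra kl_faaE.
congr (f _).
have -> : linear_faa_at snd z j = linear_faa_at idfun z.2 (map snd j).
  by case: j => [|a [|b j]].
by apply: (bra_sym_multi _).1; rewrite perm_rcons.
Qed.

Lemma kl_faa_reflect_linear A B A' B' (Phi : kl A B -> kl A' B')
    (Psi : faa A B -> faa A' B') :
  (forall f, kl_faa (Phi f) = Psi (kl_faa f)) -> is_linear Psi ->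
  is_linear Phi.
Proof.
move=> PhiE [PsiZ PsiD]; have Z := (kl_faa_linear _ _).1.
have D := (kl_faa_linear _ _).2.
split=> [a f|f g]; apply: kl_faa_inj; first by rewrite PhiE !Z PsiZ PhiE.
by rewrite PhiE !D PsiD !PhiE.
Qed.

Lemma Kl_is_cdc : is_cdc (Kl_cdc k).
Proof.
have Fcdc := Faa_is_cdc k.
have faaE := (kl_faa_comp, kl_faa_id, kl_faa_fst, kl_faa_snd, kl_faa_D,
  kl_faa_pair, kl_faa0).
split=> /=.
- by move=> A B f; apply: kl_faa_inj; rewrite !faaE; exact: (comp_id_l Fcdc).
- by move=> A B f; apply: kl_faa_inj; rewrite !faaE; exact: (comp_id_r Fcdc).
- by move=> A B C D h g f; apply: kl_faa_inj; rewrite !faaE; exact: faa_compA.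
- move=> A B C f.
  apply: (kl_faa_reflect_linear (Psi := fun g => faa_comp g (kl_faa f))).
    by move=> g; rewrite !faaE.
  exact: faa_comp_is_linear.
- by move=> A f g; apply: kl_faa_inj; exact: (one_terminal Fcdc).
- by move=> X A B f g; apply: kl_faa_inj; rewrite !faaE;
    exact: (pr0_pair Fcdc).
- by move=> X A B f g; apply: kl_faa_inj; rewrite !faaE;
    exact: (pr1_pair Fcdc).
- by move=> X A B h; apply: kl_faa_inj; rewrite !faaE; exact: faa_pair_comp.
- move=> X A B; apply: is_linear_pair.
    apply: (kl_faa_reflect_linear (Psi := faa_comp (faa_fst A B))).
      by move=> h; rewrite !faaE.
    exact: faa_comp_linear_is_linear.
  apply: (kl_faa_reflect_linear (Psi := faa_comp (faa_snd A B))).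
    by move=> h; rewrite !faaE.
  exact: faa_comp_linear_is_linear.
- move=> A B; apply: (kl_faa_reflect_linear (Psi := @faa_D k A B)).
    exact: kl_faa_D.
  exact: faa_D_is_linear.
- move=> X A B f x; apply: (kl_faa_reflect_linear (Psi := fun v =>
    faa_comp (faa_D (kl_faa f)) (faa_pair (kl_faa x) v))).
    by move=> v; rewrite !faaE.
  exact: faa_D_linear2.
- by move=> A B; apply: kl_faa_inj; rewrite !faaE; exact: faa_D_linear.
- by move=> A B; apply: kl_faa_inj; rewrite !faaE; exact: faa_D_linear.
- by move=> A; apply: kl_faa_inj; rewrite !faaE; exact: (diff_id Fcdc).
- by move=> A B C g f; apply: kl_faa_inj; rewrite !faaE; exact: faa_D_comp.
- by move=> X A B f x r v; apply: kl_faa_inj; rewrite !faaE;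
    exact: faa_DD_lin.
- by move=> X A B f x r s; apply: kl_faa_inj; rewrite !faaE;
    exact: faa_DD_sym.
Qed.

End CoKleisliFaa.

(* The last conjunct is an isomorphism of cartesian differential categories;
   the first two state that its source and target are such categories. *)
Theorem proposition4p9 (k : comPzSemiRingType) :
  [/\ is_cdc (Kl_cdc k), is_cdc (Faa_cdc k) &
      inhabited (cdc_iso (Kl_cdc k) (Faa_cdc k))].
Proof.
have Fcdc := Faa_is_cdc k.
split; [exact: Kl_is_cdc | exact: Fcdc | constructor].
(* The two categories have the same objects and the same products of objects,
   so that the comparison of products is the identity. *)
unshelve eapply (@Build_cdc_iso k (Kl_cdc k) (Faa_cdc k) id (@kl_faa k)).
all: rewrite /=; try by [].
- by exists id.
- move=> A B; exists (@Qlift k A B).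
    exact: Qlift_kl_faa.
  exact: kl_faa_Qlift.
- exact: kl_faa_id.
- exact: kl_faa_comp.
- exact: kl_faa_linear.
- by move=> A B; rewrite kl_faa_fst; exact: (esym (comp_id_r Fcdc _)).
- by move=> A B; rewrite kl_faa_snd; exact: (esym (comp_id_r Fcdc _)).
- by move=> A B f; rewrite kl_faa_D; exact: (esym (comp_id_r Fcdc _)).
Qed.
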